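(* Let $p$ be a prime and let $\mathcal{G}\subseteq\mathbb{F}_p^*$ be a multiplicative subgroup of order $T\le p^{2/3}$. Then, as $p\to\infty$, $$\left|\sum_{\lambda,\mu\in\mathcal{G}}\chi(a+\lambda+\mu)\right|\le\begin{cases}T^{19/26}\,p^{1/2+o(1)}, & \text{if } T\le p^{1/2},\\ T^{9/13}\,p^{27/52+o(1)}, & \text{if } p^{1/2}<T\le p^{29/48},\\ T\,p^{1/3+o(1)}, & \text{if } p^{29/48}<T\le p^{2/3},\end{cases}$$ uniformly over $a\in\mathbb{F}_p^*$ and nonprincipal multiplicative characters $\chi$ of $\mathbb{F}_p$.
   Context: $\mathbb{F}_p$ is the field of $p$ elements. A multiplicative character $\chi$ of $\mathbb{F}_p$ is extended by $\chi(0)=0$. The $o(1)$ denotes a quantity tending to $0$ as $p\to\infty$, uniformly in $\mathcal{G}$, $a$ and $\chi$; that is, for every $\epsilon>0$ the bounds hold with $o(1)$ replaced by $\epsilon$ for all sufficiently large primes $p$ (in terms of $\epsilon$ only). *)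

(* Defs.v *)
From mathcomp Require Import all_boot all_order all_algebra all_fingroup.
From mathcomp Require Import reals exp.
From mathcomp Require Import complex.

Set Implicit Arguments.
Unset Strict Implicit.
Unset Printing Implicit Defensive.

Import Order.TTheory GRing.Theory Num.Theory.
Local Open Scope ring_scope.
Local Open Scope complex_scope.

(* chi is a function on the whole of F, so the convention chi(0) = 0 is part of
   the definition.  Multiplicativity and chi(1) = 1 force chi to be nonzero on
   F^*, so its restriction there is a homomorphism to the nonzero complex
   numbers. *)
Definition mult_char (R : realType) (F : fieldType) (chi : F -> R[i]) : Prop :=
  chi 0 = 0 /\ GRing.monoid_morphism chi.

Definition nonprincipal (R : realType) (F : fieldType) (chi : F -> R[i]) : Prop :=
  exists2 x : F, x != 0 & chi x != 1.

(* The three-case bound, with the o(1) in the exponents of p replaced by e. *)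
Definition char_sum_bound (R : realType) (p T : nat) (e : R) : R :=
  let P : R := p%:R in
  let t : R := T%:R in
  if t <= P `^ (1 / 2) then t `^ (19 / 26) * P `^ (1 / 2 + e)
  else if t <= P `^ (29 / 48) then t `^ (9 / 13) * P `^ (27 / 52 + e)
  else t * P `^ (1 / 3 + e).

(* Main.v *)
Require Import Defs.
From mathcomp Require Import all_boot all_order all_algebra all_fingroup.
From mathcomp Require Import reals exp complex.
From mathcomp Require Import cyclic finfield.
From mathcomp Require Import ring lra zify.

Set Implicit Arguments.
Unset Strict Implicit.
Unset Printing Implicit Defensive.

Import Order.TTheory GRing.Theory Num.Theory.
Local Open Scope ring_scope.

(** The exponents come from the additive energy of the subgroup.  Write mu for
the subgroup of order T, r(x) for the number of y in mu with x + y in mu, and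
let E and E3 be the sums over x of r(x)^2 and r(x)^3.

Let S(b) be the sum of chi(b + l + m) over l and m in mu.  Since chi is
multiplicative, |S(b)| is constant on each coset of mu.  Hence T |S(a)|^2
is at most the sum of |S(b)|^2 over all b, which by orthogonality of the shifts
of chi is at most p E ([shifted_sum_energy]).  It remains to show, up to a
factor p^o(1), that E is at most T^(32/13) when T <= p^(1/2), and at most the
larger of T^(31/13) p^(1/26) and T^3 p^(-1/3) when p^(1/2) <= T <= p^(2/3).

The arithmetic input is Stepanov's method.  If U and V are sets of T-th powers,
a polynomial in X, X^T and (1-X)^T that vanishes to high order at every z with
z^T in U and (1-z)^T in V bounds the number of such z ([stepanov_bound]).  Such
z parametrize the representations x = g - q with g in mu and q in a mu-invariant
set Q, so this controls how many x have many representations.  Summing over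
dyadic levels gives the third moment T |Q|^2 up to logarithms
([sum_corr_cube_le]); for Q = mu this reads E3 << T^3 log p, which is valid as
long as T^3 <= p^2.

To pass from the third moment to the second, choose a dyadic level D, on which
r is about Delta, that carries a 1/log p share of E.  The kernels r(x-z)
and 1_D(x-z) on mu x mu commute with multiplication by mu, so the constant
function is an eigenvector of both, and the first is positive semidefinite.
Together with Cauchy-Schwarz this gives

   (Delta |D|)^4 E^2 <= T^6 E3 W,    W = sum of r(a-b)^2 over a, b in D

([operator_inequality]).  W is split according to the size of r(a-b).

When T^2 <= p the part r(a-b) < 2 Delta is at most 2 Delta times the energy
between mu and D.  In the part r(a-b) >= 2 Delta the indicator of D is majorized
by r / Delta, and Cauchy-Schwarz reduces matters to energies between mu and
level sets.  All these energies are bounded by interpolating between first and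
third moments.

When T^2 > p, W is expanded over the additive characters of F_p.  The zero
frequency contributes at most E |D|^2 / p, which is what produces T^3 p^(-1/3).
At the other frequencies the transform of a mu-invariant function is controlled
by the fourth moment of the transform of mu, which equals p E
([hatabs_exp4_le]).

All these inequalities are monomial, so the exponents of E are found by taking
logarithms and solving a linear program ([energy_exponent_case1],
[energy_exponent_case2]). *)

(** * Stepanov's method *)

Lemma linear_system_solution (K : fieldType) (I J : finType) (c : I -> J -> K) :
  (#|J| < #|I|)%N ->
  exists2 l : I -> K, exists i, l i != 0 & forall j, \sum_i l i * c i j = 0.
Proof.
move=> ltJI.
pose M := \matrix_(i < #|I|, j < #|J|) c (enum_val i) (enum_val j).
have kerM : kermx M != 0.
  rewrite -mxrank_eq0 mxrank_ker -lt0n subn_gt0.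
  by apply: leq_ltn_trans ltJI; rewrite rank_leq_col.
have /rowV0Pn[v /sub_kermxP vM v0] := kerM.
exists (fun i => v 0 (enum_rank i)).
  have /rV0Pn[i vi] := v0.
  by exists (enum_val i); rewrite enum_valK.
move=> j; have := congr1 (fun w : 'rV_#|J| => w 0 (enum_rank j)) vM.
rewrite !mxE => vMj; rewrite -[RHS]vMj [RHS](reindex enum_rank) /=; last first.
  by exists enum_val => ? _; rewrite ?enum_valK ?enum_rankK.
by apply: eq_bigr => i _; rewrite mxE !enum_rankK.
Qed.

Section EulerOperator.
Variable F : fieldType.
Implicit Types f g : {poly F}.

(** The factor X (1 - X) makes every weight X^m (1-X)^n an eigenvector up to a
polynomial of degree 1, so that iterates applied to a weighted polynomial keep
the weight and raise the degree by one at each step. *)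
Definition theta f := 'X * (1 - 'X) * f^`().

(** The conjugate of [theta] by the weight X^m (1-X)^n. *)
Definition theta_twist (m n : nat) f :=
  theta f + (m%:R *: (1 - 'X) - n%:R *: 'X) * f.

Lemma thetaM f g : theta (f * g) = theta f * g + f * theta g.
Proof. by rewrite /theta derivM; ring. Qed.

Lemma theta_sum (I : finType) (l : I -> F) (f : I -> {poly F}) :
  theta (\sum_i l i *: f i) = \sum_i l i *: theta (f i).
Proof.
rewrite /theta raddf_sum mulr_sumr; apply: eq_bigr => i _.
by rewrite /= derivZ scalerAr.
Qed.

Lemma theta_weight m n :
  theta ('X^m * (1 - 'X) ^+ n) =
  (m%:R *: (1 - 'X) - n%:R *: 'X) * ('X^m * (1 - 'X) ^+ n).
Proof.
rewrite /theta derivM derivXn deriv_exp derivB derivC derivX -!mul_polyC !polyC_natr.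
case: m n => [|m] [|n]; rewrite /= ?expr0 ?exprS; ring.
Qed.

Lemma iter_theta_twist k m n f :
  iter k theta (f * ('X^m * (1 - 'X) ^+ n)) =
  iter k (theta_twist m n) f * ('X^m * (1 - 'X) ^+ n).
Proof.
elim: k => //= k ->; rewrite thetaM theta_weight /theta_twist; ring.
Qed.

Lemma iter_theta_sum (I : finType) (l : I -> F) (f : I -> {poly F}) k :
  iter k theta (\sum_i l i *: f i) = \sum_i l i *: iter k theta (f i).
Proof. by elim: k => //= k ->; rewrite theta_sum. Qed.

Lemma size_theta_twist m n f : (size (theta_twist m n f) <= (size f).+1)%N.
Proof.
have s2 (a b : F) : (size (a *: (1 - 'X) - b *: 'X : {poly F})%R <= 2)%N.
  have -> : a *: (1 - 'X) - b *: 'X = a%:P - (a + b)%:P * 'X :> {poly F}.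
    by rewrite -!mul_polyC polyCD; ring.
  apply: leq_trans (size_polyD _ _) _; rewrite geq_max size_polyN.
  rewrite (leq_trans (size_polyC_leq1 _)) //=.
  by apply: leq_trans (size_polyMleq _ _) _; rewrite size_polyX; case: size (size_polyC_leq1 (a+b)) => [|[]].
have [->|f0] := eqVneq f 0.
  by rewrite /theta_twist /theta derivC !mulr0 addr0 size_poly0.
rewrite /theta_twist /theta; apply: leq_trans (size_polyD _ _) _.
rewrite geq_max; apply/andP; split; last first.
  apply: leq_trans (size_polyMleq _ _) _.
  by rewrite -subn1 leq_subLR add1n -addn2 addnC leq_add2l; apply: s2.
apply: leq_trans (size_polyMleq _ _) _.
have s3 : (size ('X * (1 - 'X) : {poly F})%R <= 3)%N.
  apply: leq_trans (size_polyMleq _ _) _; rewrite size_polyX /=.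
  by have := s2 1 0; rewrite scale1r scale0r subr0.
rewrite -subn1 leq_subLR add1n.
apply: leq_trans (leq_add s3 (leqnn _)) _.
by rewrite !ltnS; apply: lt_size_deriv.
Qed.

Lemma size_iter_theta_twist k m n f :
  (size (iter k (theta_twist m n) f) <= size f + k)%N.
Proof.
elim: k => [|k IH] /=; first by rewrite addn0.
by apply: leq_trans (size_theta_twist _ _ _) _; rewrite addnS.
Qed.

End EulerOperator.

Section Stepanov.
Variable p : nat.
Hypothesis p_pr : prime p.
Local Notation F := 'F_p.
Implicit Types f q : {poly F}.

Lemma Fp_natr_neq0 n : (0 < n)%N -> (n < p)%N -> n%:R != 0 :> F.
Proof.
move=> n0 np; rewrite -(dvdn_pcharf (pchar_Fp p_pr)).
by apply/negP => /dvdn_leq; lia.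
Qed.

(** One application of [theta] lowers the multiplicity j of a root z by exactly
one: the new leading factor is j z (1-z), which is nonzero since j < p. *)
Lemma iter_theta_order (z : F) j q : z != 0 -> z != 1 -> (j < p)%N ->
  ~~ root q z -> ~~ root (iter j (@theta F) (q * ('X - z%:P) ^+ j)) z.
Proof.
move=> z0 z1; elim: j q => [|j IH] q jp qz; first by rewrite expr0 mulr1.
rewrite iterSr.
have -> : theta (q * ('X - z%:P) ^+ j.+1) =
   (theta q * ('X - z%:P) + j.+1%:R *: ('X * (1 - 'X) * q)) * ('X - z%:P) ^+ j.
  rewrite thetaM /theta deriv_exp derivXsubC -mul_polyC polyC_natr /= exprS; ring.
apply: IH; first lia.
rewrite rootE !hornerE subrr mulr0 add0r.
by rewrite !mulf_neq0 ?Fp_natr_neq0 // subr_eq0 eq_sym.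
Qed.

Lemma iter_theta_dvdp (z : F) D f : z != 0 -> z != 1 -> (D <= p)%N ->
  (forall k, (k < D)%N -> root (iter k (@theta F) f) z) -> ('X - z%:P) ^+ D %| f.
Proof.
move=> z0 z1 Dp fz; have [->|f0] := eqVneq f 0; first by rewrite dvdp0.
have [m [q]] := multiplicity_XsubC f z; rewrite f0 /= => qz fE.
have [Dm|mD] := leqP D m.
  by rewrite fE dvdp_mull // dvdp_exp2l.
by have := fz _ mD; rewrite fE (negPf (iter_theta_order _ _ _ qz)) //; lia.
Qed.

Lemma prod_XsubC_exp_dvdp (R : {set F}) D f :
  (forall z, z \in R -> ('X - z%:P) ^+ D %| f) ->
  \prod_(z in R) ('X - z%:P) ^+ D %| f.
Proof.
rewrite -big_enum /= => dvdf.
have : forall z, z \in enum R -> ('X - z%:P) ^+ D %| f.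
  by move=> z; rewrite mem_enum; apply: dvdf.
elim: (enum R) (enum_uniq R) => [|z s IH]; first by rewrite big_nil dvd1p.
rewrite cons_uniq big_cons => /andP[zs us] df.
rewrite Gauss_dvdp; last first.
  apply: coprimep_expl; rewrite coprimep_sym coprimep_XsubC.
  rewrite rootE horner_prod prodf_seq_neq0; apply/allP => y ys /=.
  rewrite horner_exp !hornerE expf_neq0 // subr_eq0.
  by apply: contraNneq zs => ->.
by rewrite df ?mem_head //= IH // => y ys; apply: df; rewrite inE ys orbT.
Qed.

(** Vanishing to order n at 1 forces more than n nonzero coefficients.  If X^e
occurs in f, then X f' - e f has lost that monomial and no other one gained, and
its order at 1 has dropped by at most one; induction on n applies.  The degree
bound makes i - e invertible modulo p for every other exponent i. *)
Lemma sparse_poly_eq0 n f : (size f <= p)%N ->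
  (#|[set i : 'I_p | (f`_i != 0)%R]| <= n)%N -> ('X - 1) ^+ n %| f -> f = 0.
Proof.
elim: n f => [|n IH] f sf supp df.
  apply/polyP => i; rewrite coef0.
  have [ip|/(leq_trans sf)/leq_sizeP/(_ i (leqnn _))//] := ltnP i p.
  apply/eqP; rewrite -[_ == _]negbK; apply/negP => fi.
  move: supp; rewrite leqn0 cards_eq0 => /eqP/setP/(_ (Ordinal ip)).
  by rewrite !inE /= fi.
apply/eqP; rewrite -[_ == _]negbK; apply/negP => f0.
have ep : ((size f).-1 < p)%N by have := prime_gt0 p_pr; case: (size f) sf => [|k]; lia.
set e := (size f).-1 in ep.
have fe : f`_e != 0 by rewrite -[f`_e]/(lead_coef f) lead_coef_eq0.
(* X f' - e f kills the leading monomial X^e *)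
pose g := 'X * f^`() - e%:R *: f.
have gE i : g`_i = (i%:R - e%:R) * f`_i.
  rewrite coefB coefXM coefZ coef_deriv mulrBl; case: i => [|i] /=.
    by rewrite mul0r.
  by rewrite !mulr_natl.
have g0 : g = 0.
  apply: IH.
  - apply/leq_sizeP => i /(leq_trans sf) /leq_sizeP fi.
    by rewrite gE fi // mulr0.
  - rewrite -ltnS; apply: leq_trans supp; apply: proper_card; apply/properP; split.
      by apply/subsetP => i; rewrite !inE gE mulf_eq0 negb_or => /andP[].
    by exists (Ordinal ep); rewrite !inE //= gE subrr mul0r eqxx.
  - rewrite /g; have /dvdpP[h ->] := df.
    apply: dvdp_sub; last first.
      by rewrite -mul_polyC; do 2 apply: dvdp_mull; rewrite exprS dvdp_mull.
    apply: dvdp_mull; rewrite derivM dvdp_add //.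
      by apply: dvdp_mull; rewrite exprS dvdp_mull.
    apply: dvdp_mull; rewrite deriv_exp /=.
    by rewrite -mulr_natr -!mulrA; apply: dvdp_mull; rewrite dvdp_mulr.
have fi i : i != e -> f`_i = 0.
  move=> ie; have [ip|/(leq_trans sf)/leq_sizeP/(_ i (leqnn _))//] := ltnP i p.
  have := gE i; rewrite g0 coef0 => /esym/eqP; rewrite mulf_eq0 => /orP[|/eqP//].
  have [lt_ie|lt_ei|] := ltngtP i e; last by move/eqP: ie.
    rewrite -opprB oppr_eq0 -natrB 1?ltnW // (negPf (Fp_natr_neq0 _ _)) //; lia.
  rewrite -natrB 1?ltnW // (negPf (Fp_natr_neq0 _ _)) //; lia.
have fE : f = f`_e *: 'X^e.
  apply/polyP => i; rewrite coefZ coefXn; have [->|/fi->] := eqVneq i e.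
    by rewrite mulr1.
  by rewrite mulr0.
have : root f 1.
  rewrite root_factor_theorem; apply: dvdp_trans df.
  by rewrite exprS dvdp_mulr.
by rewrite rootE fE !hornerE expr1n mulr1 (negPf fe).
Qed.
End Stepanov.

Section StepanovBound.
Variable p : nat.
Hypothesis p_pr : prime p.
Local Notation F := 'F_p.
Variables (T A B : nat).
Local Notation index := ('I_A * 'I_B * 'I_B)%type.

(** At a point z with z^T = u and (1-z)^T = v this monomial takes the value
u^b v^c z^a, of degree less than A in z although the monomial itself has degree
of order T B. *)
Definition aux_monomial (i : index) : {poly F} :=
  'X^(i.1.1) * ('X^(T * i.1.2) * (1 - 'X) ^+ (T * i.2)).

(** Suppose the combination vanishes and let c be the least power of (1-X)^T that
occurs.  Its cofactor is then divisible by (1-X)^T, yet it has at most A B <= T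
monomials and degree less than p, contradicting [sparse_poly_eq0]. *)
Lemma aux_poly_neq0 (l : index -> F) : (A * B <= T)%N -> (T * B <= p)%N ->
  (exists i, l i != 0) -> \sum_i l i *: aux_monomial i != 0.
Proof.
move=> leAB leTB [j0 lj0].
(* a term of the combination with the least power of (1-X)^T *)
have [i0 li0 min_i0] := @arg_minnP _ j0 (fun i => l i != 0) (fun i : index => nat_of_ord i.2) lj0.
have B0 : (0 < B)%N by case: i0 {li0 min_i0} => [[_ b] _]; apply: leq_ltn_trans (ltn_ord b).
have AT : (A <= T)%N by apply: leq_trans leAB; rewrite leq_pmulr.
pose f : {poly F} := \sum_(i : index | i.2 == i0.2) l i *: 'X^(i.1.1 + T * i.1.2).
apply/negP => /eqP psi0.
have fE : f * (1 - 'X) ^+ (T * i0.2) =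
    - \sum_(i : index | i.2 != i0.2) l i *: aux_monomial i.
  apply/eqP; rewrite -addr_eq0 -[X in _ == X]psi0 [X in _ == X](bigID (fun i : index => i.2 == i0.2)) /=.
  apply/eqP; congr (_ + _); rewrite /f mulr_suml; apply: eq_bigr => i /eqP i2.
  by rewrite /aux_monomial i2 -scalerAl exprD -mulrA.
have df : (1 - 'X) ^+ T %| f.
  have nz : (1 - 'X : {poly F}) ^+ (T * i0.2) != 0.
    by rewrite expf_neq0 // subr_eq0 eq_sym -[1]/(polyC 1) -subr_eq0 polyXsubC_eq0.
  rewrite -(dvdp_mul2r _ _ nz) fE dvdpNr.
  apply: (big_ind (fun g => _ %| g)) => [|g h|i i2]; [exact: dvdp0|exact: dvdp_add|].
  have [->|li] := eqVneq (l i) 0; first by rewrite scale0r dvdp0.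
  rewrite -mul_polyC /aux_monomial; do 3 apply: dvdp_mull.
  rewrite -exprD dvdp_exp2l // -mulnS leq_mul2l; apply/orP; right.
  by rewrite ltn_neqAle eq_sym i2 min_i0.
have f0 : f = 0.
  apply: (sparse_poly_eq0 (n := T) p_pr).
  - apply: (big_ind (fun g : {poly F} => (size g <= p)%N)) => [|g h sg sh|i _].
    + by rewrite size_poly0.
    + by apply: leq_trans (size_polyD _ _) _; rewrite geq_max sg.
    + apply: leq_trans (size_scale_leq _ _) _; rewrite size_polyXn.
      apply: leq_trans leTB.
      have := leq_trans (ltn_ord i.1.1) AT; have := ltn_ord i.1.2.
      by move: (nat_of_ord _) (nat_of_ord _) => *; nia.
  - apply: leq_trans (_ : #|{: 'I_A * 'I_B}| <= _)%N; last by rewrite card_prod !card_ord.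
    pose h (i : 'I_p) : option ('I_A * 'I_B) :=
      [pick ab : 'I_A * 'I_B | i == (ab.1 + T * ab.2)%N :> nat].
    have hP (i : 'I_p) : f`_i != 0 -> exists2 ab, h i = Some ab & i = (ab.1 + T * ab.2)%N :> nat.
      move=> fi; rewrite /h; case: pickP => [ab /eqP iab|nab]; first by exists ab.
      case/eqP: fi; rewrite coef_sum big1 // => j _.
      by rewrite coefZ coefXn nab mulr0.
    rewrite -(card_in_imset (f := h)); last first.
      move=> i j; rewrite !inE => /hP[ab -> iE] /hP[cd -> jE] [E].
      by apply: val_inj; rewrite /= iE jE E.
    have Some_inj : injective (@Some ('I_A * 'I_B)%type) by move=> x y [].
    rewrite -cardsT -(card_imset _ Some_inj).
    apply: subset_leq_card; apply/subsetP => _ /imsetP[i + ->].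
    by rewrite inE => /hP[ab -> _]; apply: imset_f.
  - by apply: dvdp_trans df; rewrite -[1 - 'X]opprB exprNn dvdp_mull.
have : f`_(i0.1.1 + T * i0.1.2) = l i0.
  rewrite coef_sum (bigD1 i0) //= coefZ coefXn eqxx mulr1 big1 ?addr0 // => i.
  move=> /andP[/eqP i2 ii0]; rewrite coefZ coefXn.
  case: eqP => [E|]; last by rewrite mulr0.
  case/eqP: ii0; case: i i0 i2 E {li0 min_i0 f fE df f0} => [[a b] c] [[a' b'] c'] /= -> E.
  have aT := leq_trans (ltn_ord a) AT; have a'T := leq_trans (ltn_ord a') AT.
  have Ea : a = a' :> nat.
    rewrite -(modn_small aT) -(modn_small a'T) -(modnMDl b a) -(modnMDl b' a').
    by rewrite ![(_ * T + _)%N]addnC ![(_ * T)%N]mulnC E.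
  congr (_, _, _); first exact: val_inj.
  by apply: val_inj => /=; have T0 : (0 < T)%N := leq_ltn_trans (leq0n _) aT; nia.
by rewrite f0 coef0 => /esym/eqP; rewrite (negPf li0).
Qed.

End StepanovBound.

(** With A = T / B there are A B^2 coefficients to choose.  Asking the combination to
vanish to order A at all the points in question costs at most |U| |V| A (2 A)
linear equations: for each pair (u, v) and each iterate of [theta], one
polynomial of degree less than 2 A has to be zero.  A nonzero solution has degree
less than A + 2 T B, hence fewer than 1 + 2 T B / A <= 1 + 4 B^2 roots of
multiplicity A. *)
Theorem stepanov_bound p (T B : nat) (U V : {set 'F_p}) :
  prime p -> 0 \notin U -> 0 \notin V -> (2 * (#|U| * #|V| * T) < B ^ 3)%N ->
  (B <= T)%N -> (T * B <= p)%N ->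
  (#|[set z : 'F_p | (z ^+ T \in U) && ((1 - z) ^+ T \in V)]| <= 5 * B ^ 2)%N.
Proof.
move=> p_pr U0 V0 small BT TBp; set R := [set z | _].
have B0 : (0 < B)%N by case: (B) small.
have T0 : (0 < T)%N := leq_trans B0 BT.
pose A := (T %/ B)%N.
have A0 : (0 < A)%N by rewrite divn_gt0.
have leAB : (A * B <= T)%N by apply: leq_trunc_div.
have TltA : (T < A.+1 * B)%N by rewrite ltn_ceil.
pose I := ('I_A * 'I_B * 'I_B)%type.
pose J := ('I_#|U| * 'I_#|V| * 'I_A * 'I_(A + A))%type.
pose c (i : I) (j : J) : 'F_p :=
  (enum_val j.1.1.1 : 'F_p) ^+ i.1.2 * (enum_val j.1.1.2 : 'F_p) ^+ i.2 *
  (iter j.1.2 (theta_twist (T * i.1.2) (T * i.2)) 'X^(i.1.1))`_j.2.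
have [|l l0 lc] := @linear_system_solution 'F_p I J c.
  rewrite !card_prod !card_ord.
  have : (#|U| * #|V| * (A + A) < B * B)%N.
    rewrite -(ltn_pmul2r B0) mulnn -expnSr; apply: leq_ltn_trans small.
    have := leq_mul (leqnn (2 * (#|U| * #|V|))) leAB.
    by move: (A) #|U| #|V| => *; nia.
  by nia.
pose psi : {poly 'F_p} := \sum_i l i *: aux_monomial p T i.
have psi0 : psi != 0 by apply: aux_poly_neq0.
have Ap : (A <= p)%N by nia.
have dvd_psi z : z \in R -> ('X - z%:P) ^+ A %| psi.
  rewrite inE => /andP[zU zV].
  have z0 : z != 0 by apply: contraNneq U0 => z0; move: zU; rewrite z0 expr0n gtn_eqF.
  have z1 : z != 1 by apply: contraNneq V0 => z1; move: zV; rewrite z1 subrr expr0n gtn_eqF.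
  apply: iter_theta_dvdp => // k kA.
  pose g : {poly 'F_p} := \sum_(i : I) (l i * ((z ^+ T) ^+ i.1.2 * ((1 - z) ^+ T) ^+ i.2))
      *: iter k (theta_twist (T * i.1.2) (T * i.2)) 'X^(i.1.1).
  have g0 : g = 0.
    apply/polyP => d; rewrite coef0 coef_sum.
    have [dA|Ad] := ltnP d (A + A); last first.
      rewrite big1 // => i _; rewrite coefZ.
      have /leq_sizeP->// : (size (iter k (theta_twist (T * i.1.2) (T * i.2)) ('X^(i.1.1) : {poly 'F_p})) <= d)%N.
        apply: leq_trans (size_iter_theta_twist _ _ _ _) _.
        by rewrite size_polyXn; apply: leq_trans Ad; rewrite leq_add // ltnW.
      by rewrite mulr0.
    rewrite -[RHS](lc (enum_rank_in zU (z ^+ T), enum_rank_in zV ((1 - z) ^+ T), Ordinal kA, Ordinal dA)).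
    by apply: eq_bigr => i _; rewrite coefZ /c /= !enum_rankK_in // -!mulrA.
  have -> : root (iter k (@theta _) psi) z = root g z; last by rewrite g0 root0.
  rewrite !rootE iter_theta_sum !horner_sum; congr (_ == _); apply: eq_bigr => i _.
  rewrite /aux_monomial iter_theta_twist !hornerZ !hornerM hornerXn horner_exp hornerD hornerN hornerX hornerC -!exprM; ring.
have /dvdp_leq-/(_ psi0) := prod_XsubC_exp_dvdp dvd_psi.
have -> : size (\prod_(z in R) ('X - z%:P : {poly 'F_p}) ^+ A) = (A * #|R|).+1.
  rewrite size_prod; last by move=> z _; rewrite expf_neq0 ?polyXsubC_eq0.
  under eq_bigr do rewrite size_exp_XsubC.
  by rewrite sum_nat_const mulnS -addnS addKn mulnC.
have : (size psi <= A + 2 * (T * B))%N.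
  apply: (big_ind (fun g : {poly 'F_p} => (size g <= A + 2 * (T * B))%N)) => [|g h sg sh|i _].
  - by rewrite size_poly0.
  - by apply: leq_trans (size_polyD _ _) _; rewrite geq_max sg.
  - apply: leq_trans (size_scale_leq _ _) _.
    have sX : size (1 - 'X : {poly 'F_p}) = 2%N by rewrite -opprB size_polyN size_XsubC.
    have := ltn_ord i.1.1; have := ltn_ord i.1.2; have := ltn_ord i.2.
    have := size_polyMleq ('X^(i.1.1) : {poly 'F_p}) ('X^(T * i.1.2) * (1 - 'X) ^+ (T * i.2)).
    have := size_polyMleq ('X^(T * i.1.2) : {poly 'F_p}) ((1 - 'X) ^+ (T * i.2)).
    have := size_poly_exp_leq (1 - 'X : {poly 'F_p}) (T * i.2).
    rewrite sX !size_polyXn /aux_monomial.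
    by move: (size _) (size _) (size _) => *; nia.
by move: (size psi) #|R| => s r *; nia.
Qed.

(** * Third moments of fibre counts *)

Lemma card_pow_fiber (F : finFieldType) (T : nat) (a : F) : (0 < T)%N ->
  (#|[set z : F | z ^+ T == a]| <= T)%N.
Proof.
move=> T0; have sX : size ('X^T - a%:P : {poly F}) = T.+1.
  by rewrite size_XnsubC.
have X0 : 'X^T - a%:P != 0 :> {poly F} by rewrite -size_poly_eq0 sX.
rewrite cardE -ltnS -sX; apply: max_poly_roots X0 _ _.
  apply/allP => z; rewrite mem_enum inE => /eqP zT.
  by rewrite rootE !hornerE zT subrr.
exact: enum_uniq.
Qed.

Lemma exists_subset_card (I : finType) (A : {set I}) k : (k <= #|A|)%N ->
  exists2 B : {set I}, B \subset A & #|B| = k.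
Proof.
move=> kA; exists [set x in take k (enum A)].
  by apply/subsetP => x; rewrite inE => /mem_take; rewrite mem_enum.
rewrite cardsE (card_uniqP _) ?take_uniq ?enum_uniq // size_take.
by rewrite -cardE; case: ltngtP kA.
Qed.

Section LevelSets.
Variable p : nat.
Hypothesis p_pr : prime p.
Local Notation F := 'F_p.
Variables (T : nat) (U : {set F}).
Hypotheses (T_gt0 : (0 < T)%N) (U_neq0 : 0 \notin U) (U_gt0 : (0 < #|U|)%N).
Local Notation Q := (#|U| * T)%N.

(** For fixed v, the number of representations of an element x with x^T = v as a
difference of an element of mu and an element of the set with T-th powers U. *)
Definition fiber_count (v : F) : nat :=
  #|[set z : F | (z ^+ T \in U) && ((1 - z) ^+ T == v)]|.

Definition level_set (w : nat) : {set F} :=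
  [set v | (v != 0) && (w <= fiber_count v)%N].

Lemma sum_fiber_count (V : {set F}) :
  (\sum_(v in V) fiber_count v)%N =
  #|[set z : F | (z ^+ T \in U) && ((1 - z) ^+ T \in V)]|.
Proof.
rewrite -sum1_card [RHS](partition_big (fun z => (1 - z) ^+ T) (mem V)); last first.
  by move=> z; rewrite inE => /andP[].
apply: eq_bigr => v vV; rewrite /fiber_count -sum1_card; apply: eq_bigl => z.
by rewrite !inE; case: eqP => [->|_]; rewrite ?vV ?andbF ?andbT.
Qed.

Lemma sum_fiber_count_le : (\sum_v fiber_count v <= Q)%N.
Proof.
rewrite -(eq_bigl _ _ (@in_setT F)).
rewrite sum_fiber_count -sum1_card.
rewrite [leqLHS](partition_big (fun z => z ^+ T) (mem U)); last first.
  by move=> z; rewrite !inE => /andP[].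
rewrite -sum_nat_const; apply: leq_sum => u uU; rewrite sum1_card.
apply: leq_trans (card_pow_fiber u T_gt0); apply: subset_leq_card.
by apply/subsetP => z; rewrite unfold_in !inE => /andP[].
Qed.

Lemma fiber_count_leQ v : (fiber_count v <= Q)%N.
Proof.
by apply: leq_trans sum_fiber_count_le; rewrite (bigD1 v) //= leq_addr.
Qed.

Lemma fiber_count_le B v : v != 0 -> (2 * Q < B ^ 3)%N -> (B <= T)%N ->
  (T * B <= p)%N -> (fiber_count v <= 5 * B ^ 2)%N.
Proof.
move=> v0 QB BT TBp; have := @stepanov_bound p T B U [set v] p_pr U_neq0.
rewrite inE eq_sym v0 cards1 muln1 => /(_ isT QB BT TBp).
by rewrite -sum_fiber_count big_set1.
Qed.

(** If the level set had at least B^3 / (2 Q) elements, the largest subset that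
[stepanov_bound] accepts would have k > B^3 / (4 Q) elements and at least
k w >= 20 k Q / B > 5 B^2 points above it. *)
Lemma card_level_set w B : (B <= T)%N -> (T * B <= p)%N -> (4 * Q < B ^ 3)%N ->
  (20 * Q <= B * w)%N -> (2 * (#|level_set w| * Q) < B ^ 3)%N.
Proof.
move=> BT TBp QB QBw; rewrite ltnNge; apply/negP => le_lev.
have Q0 : (0 < Q)%N by rewrite muln_gt0 U_gt0.
(* the largest k with 2 Q k < B ^ 3 *)
pose k := ((B ^ 3).-1 %/ (2 * Q))%N.
have kB : (k * (2 * Q) < B ^ 3)%N.
  by have := leq_trunc_div (B ^ 3).-1 (2 * Q); rewrite -/k; lia.
have Bk : (B ^ 3 <= k.+1 * (2 * Q))%N.
  have : ((B ^ 3).-1 < k.+1 * (2 * Q))%N by rewrite ltn_ceil // muln_gt0.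
  by lia.
have [|V VL Vk] := @exists_subset_card _ (level_set w) k.
  rewrite -ltnS; move: le_lev kB Q0; move: (B ^ 3)%N Q #|level_set w| => b q l.
  by nia.
have V0 : 0 \notin V by apply/negP => /(subsetP VL); rewrite inE eqxx.
have := @stepanov_bound p T B U V p_pr U_neq0 V0.
rewrite -sum_fiber_count Vk => /(_ _ BT TBp) st.
have wk : (w * k <= \sum_(v in V) fiber_count v)%N.
  rewrite -Vk mulnC -sum_nat_const; apply: leq_sum => v /(subsetP VL).
  by rewrite inE => /andP[].
have {}st : (w * k <= 5 * B ^ 2)%N.
  by apply: leq_trans wk (st _); move: kB; rewrite -!mulnA; nia.
have : (20 * Q * k <= 5 * B ^ 3)%N.
  apply: leq_trans (_ : B * w * k <= _)%N; first by rewrite leq_mul2r QBw orbT.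
  by rewrite -mulnA expnS [leqRHS]mulnCA leq_mul2l st orbT.
by move: QB Bk; move: (B ^ 3)%N Q => b q; nia.
Qed.

Variable B0 : nat.
Hypotheses (B0T : (B0 <= T)%N) (TB0 : (T * B0 <= p)%N) (B0_ge : (17 <= B0)%N)
  (QB0 : (Q <= 4 * B0 ^ 2)%N).

(** The optimal parameter is B = 20 Q / w, provided it exceeds the cube root of 4 Q;
otherwise the level w is so high that the pointwise bound [fiber_count_le]
limits w itself: then w^3 <= 2^19 Q^2 and the level set has at most 2^4 elements,
whence 2^23.  The letter c stands for any absolute constant of at least this size. *)
Lemma card_level_set_cube c w : (2 ^ 23 <= c)%N -> (20 * Q <= B0 * w)%N ->
  (w ^ 3 * #|level_set w| <= c * Q ^ 2)%N.
Proof.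
move=> c_ge B0w; have [->|/set0Pn[v]] := eqVneq (level_set w) set0.
  by rewrite cards0 muln0.
rewrite inE => /andP[v0 wv].
have Q0 : (0 < Q)%N by rewrite muln_gt0 U_gt0.
have w0 : (0 < w)%N by move: B0w; case: (w) => //; rewrite muln0; lia.
have okB0 : (4 * Q < B0 ^ 3)%N.
  apply: leq_ltn_trans (_ : 16 * B0 ^ 2 < _)%N.
    by rewrite (_ : 16 = 4 * 4)%N // -mulnA leq_mul2l.
  by rewrite [ltnRHS]expnS ltn_pmul2r // expn_gt0; apply/orP; left; lia.
have exB1 : exists B, (4 * Q < B ^ 3)%N by exists B0.
(* B1 is about the cube root of 4 Q, the least parameter that card_level_set
   accepts; B0 >= 17 and Q <= 4 B0 ^ 2 ensure B1 <= B0 *)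
case: (ex_minnP exB1) => B1 okB1 minB1.
have B1B0 : (B1 <= B0)%N by apply: minB1.
have B1_ge2 : (2 <= B1)%N.
  by rewrite ltnNge; apply/negP => B11; move: okB1; rewrite -[(B1 ^ 3)%N]/(B1 * (B1 * B1))%N; nia.
have B1le : (B1 ^ 3 <= 32 * Q)%N.
  have : ~~ (4 * Q < B1.-1 ^ 3)%N by apply/negP => /minB1; lia.
  rewrite -leqNgt => le4; apply: leq_trans (_ : 8 * (B1.-1 ^ 3) <= _)%N; last by lia.
  by rewrite (_ : 8 = 2 ^ 3)%N // -expnMn leq_exp2r //; lia.
have exB2 : exists B, (20 * Q <= B * w)%N by exists B0.
(* B2 is the ceiling of 20 Q / w *)
case: (ex_minnP exB2) => B2 okB2 minB2.
have B2B0 : (B2 <= B0)%N by apply: minB2.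
have wQ : (w <= Q)%N := leq_trans wv (fiber_count_leQ v).
have B2w : (B2 * w <= 21 * Q)%N.
  have B2_gt0 : (0 < B2)%N by case: (B2) okB2 => //; lia.
  have : ~~ (20 * Q <= B2.-1 * w)%N by apply/negP => /minB2; lia.
  by move: B2_gt0 wQ; move: Q => q; nia.
have TB B : (B <= B0)%N -> (T * B <= p)%N.
  by move=> BB0; apply: leq_trans TB0; rewrite leq_mul2l BB0 orbT.
have [B12|B21] := leqP B1 B2.
- have okB : (4 * Q < B2 ^ 3)%N by apply: leq_trans okB1 _; rewrite leq_exp2r.
  have := card_level_set (leq_trans B2B0 B0T) (TB _ B2B0) okB okB2.
  move=> lev; rewrite -(leq_pmul2r Q0) -[leqRHS]mulnA -expnSr -[leqLHS]mulnA.
  apply: leq_trans (_ : w ^ 3 * (2 * (#|level_set w| * Q)) <= _)%N.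
    by rewrite leq_mul2l mul2n -addnn leq_addr orbT.
  apply: leq_trans (_ : (B2 * w) ^ 3 <= _)%N.
    by rewrite expnMn mulnC leq_mul2r ltnW ?orbT.
  apply: leq_trans (_ : (2 ^ 5 * Q) ^ 3 <= _)%N.
    by rewrite leq_exp2r // (leq_trans B2w) // leq_mul.
  rewrite expnMn -expnM leq_mul2r; apply/orP; right.
  by apply: leq_trans c_ge; rewrite leq_exp2l.
- have okB : (20 * Q <= B1 * w)%N.
    by apply: leq_trans okB2 _; rewrite leq_mul2r (ltnW B21) orbT.
  have := card_level_set (leq_trans B1B0 B0T) (TB _ B1B0) okB1 okB.
  move=> lev.
  have w8 : (w <= 2 ^ 3 * B1 ^ 2)%N.
    apply: leq_trans (_ : 5 * B1 ^ 2 <= _)%N; last by rewrite leq_mul.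
    apply: leq_trans wv _; apply: fiber_count_le => //; first by lia.
      exact: leq_trans B1B0 B0T.
    exact: TB.
  have lev16 : (#|level_set w| <= 2 ^ 4)%N.
    rewrite -[(2 ^ 4)%N]/16%N.
    by move: lev B1le Q0; move: (B1 ^ 3)%N Q => b q; nia.
  have w3 : (w ^ 3 <= 2 ^ 19 * Q ^ 2)%N.
    apply: leq_trans (_ : (2 ^ 3 * B1 ^ 2) ^ 3 <= _)%N; first by rewrite leq_exp2r.
    rewrite expnMn -!expnM [(2 * 3)%N]mulnC (expnM B1).
    apply: leq_trans (_ : 2 ^ 9 * (2 ^ 5 * Q) ^ 2 <= _)%N.
      by rewrite leq_mul2l leq_exp2r // orbC B1le.
    by rewrite expnMn -expnM mulnA -expnD.
  move: (leq_mul w3 lev16) c_ge; rewrite (_ : 23 = 19 + 4)%N // expnD.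
  by move: (2 ^ 19)%N (2 ^ 4)%N (Q ^ 2)%N => a b d; nia.
Qed.

(** The dyadic levels covered by [card_level_set_cube] contribute O(Q^2) each.  On
the lower levels the count is O(Q / B0) = O(Q^(1/2)), and the first moment
suffices. *)
Lemma fiber_count_third_moment c K : (2 ^ 23 <= c)%N -> (p < 2 ^ K)%N -> (0 < K)%N ->
  (\sum_(v : F | v != 0%R) fiber_count v ^ 3 <= 9 * c * K * Q ^ 2)%N.
Proof.
move=> c_ge pK K0.
have nK v : (fiber_count v < 2 ^ K)%N.
  by apply: leq_ltn_trans pK; apply: leq_trans (max_card _) _; rewrite card_Fp.
have cube v : v != 0 -> (fiber_count v ^ 3 <=
    (if fiber_count v * B0 < 40 * Q then fiber_count v ^ 3 else 0) +
    \sum_(i < K | 20 * Q <= B0 * 2 ^ i) 8 * ((2 ^ i) ^ 3 * (v \in level_set (2 ^ i))))%N.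
  move=> v0; case: ifPn => [_|]; first by rewrite leq_addr.
  rewrite -leqNgt add0n => big_n.
  have Q0 : (0 < Q)%N by rewrite muln_gt0 U_gt0.
  have n0 : (0 < fiber_count v)%N.
    by move: big_n; case: fiber_count => //; rewrite mul0n; lia.
  have /andP[lo hi] := trunc_log_bounds (isT : (1 < 2)%N) n0.
  set i := trunc_log _ _ in lo hi.
  have iK : (i < K)%N by rewrite -(ltn_exp2l _ _ (isT : (1 < 2)%N)); apply: leq_ltn_trans lo (nK v).
  rewrite (bigD1 (Ordinal iK)) /=; last first.
    have := leq_trans big_n (leq_mul (ltnW hi) (leqnn B0)); rewrite expnS.
    by rewrite -mulnA [(2 ^ i * _)%N]mulnC; move: (B0 * 2 ^ i)%N Q => a b; lia.
  rewrite inE v0 lo muln1; apply: leq_trans (leq_addr _ _).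
  by rewrite -[8%N]/(2 ^ 3)%N -expnMn leq_exp2r // -expnS ltnW.
apply: leq_trans; first by apply: leq_sum => v; exact: cube.
rewrite big_split /=.
have small : (\sum_(v : F | v != 0%R) (if fiber_count v * B0 < 40 * Q then fiber_count v ^ 3 else 0)
   <= c * Q ^ 2)%N.
  rewrite -(leq_pmul2r (_ : 0 < B0 ^ 2)%N) ?expn_gt0; last by apply/orP; left; lia.
  rewrite big_distrl /=; apply: leq_trans (_ : \sum_v (2 ^ 6 * Q) ^ 2 * fiber_count v <= _)%N.
    apply: leq_trans (_ : \sum_(v : F | v != 0%R) (2 ^ 6 * Q) ^ 2 * fiber_count v <= _)%N; last first.
      by rewrite [leqRHS](bigID (fun v : F => v != 0%R)) leq_addr.
    apply: leq_sum => v _; case: ifP => [nB|]; last by rewrite mul0n.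
    rewrite expnSr mulnAC leq_mul2r; apply/orP; right.
    rewrite -expnMn leq_exp2r // (leq_trans (ltnW nB)) //.
    by rewrite leq_mul.
  rewrite -big_distrr /=; apply: leq_trans (_ : (2 ^ 6 * Q) ^ 2 * (2 ^ 2 * B0 ^ 2) <= _)%N.
    by rewrite leq_mul2l (leq_trans sum_fiber_count_le QB0) orbT.
  rewrite expnMn -expnM mulnACA -expnD -mulnA leq_mul2r; apply/orP; right.
  by apply: leq_trans c_ge; rewrite leq_exp2l.
have large : (\sum_(v : F | v != 0%R) \sum_(i < K | 20 * Q <= B0 * 2 ^ i)
    8 * ((2 ^ i) ^ 3 * (v \in level_set (2 ^ i))) <= K * (8 * (c * Q ^ 2)))%N.
  rewrite exchange_big /=.
  apply: leq_trans (_ : \sum_(i < K | 20 * Q <= B0 * 2 ^ i) 8 * (c * Q ^ 2) <= _)%N.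
    apply: leq_sum => i Bi; rewrite -big_distrr leq_mul2l /= -big_distrr /=.
    apply: leq_trans (card_level_set_cube c_ge Bi); rewrite leq_mul2l -sum1_card big_mkcond /=.
    rewrite [leqRHS]big_mkcond /=; apply/orP; right; apply: leq_sum => v _.
    by case: (v != 0) => //; case: (v \in _).
  apply: leq_trans (_ : \sum_(i < K) 8 * (c * Q ^ 2) <= _)%N.
    by rewrite big_mkcond /=; apply: leq_sum => i _; case: ifP.
  by rewrite sum_nat_const card_ord.
apply: leq_trans (leq_add small large) _.
by move: (Q ^ 2)%N => q; nia.
Qed.
End LevelSets.

(** * Correlations and the operator inequality *)

Lemma cauchy_schwarz_sum (R : realFieldType) (I : finType) (w a b : I -> R) :
  (forall i, 0 <= w i) ->
  (\sum_i w i * a i * b i) ^+ 2 <=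
  (\sum_i w i * a i ^+ 2) * (\sum_i w i * b i ^+ 2).
Proof.
move=> w0; set X := \sum_i _ * a i ^+ 2; set Y := \sum_i _ * b i ^+ 2; set Z := \sum_i _.
have : 0 <= \sum_i \sum_j w i * w j * (a i * b j - a j * b i) ^+ 2.
  by do 2 (apply: sumr_ge0 => ? _); apply: mulr_ge0 (sqr_ge0 _); apply: mulr_ge0.
suff -> : \sum_i \sum_j w i * w j * (a i * b j - a j * b i) ^+ 2
    = X * Y + Y * X - 2%:R * (Z * Z) by rewrite -expr2; lra.
rewrite !big_distrlr /= mulr_sumr -big_split -sumrB /=; apply: eq_bigr => i _.
rewrite mulr_sumr -big_split -sumrB /=; apply: eq_bigr => j _; ring.
Qed.

Section Correlation.
Variables (R : realFieldType) (F : finFieldType).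
Implicit Types (f g h k : F -> R) (A B : {set F}).

Definition indic A : F -> R := fun x => (x \in A)%:R.

(** For indicator functions of A and B this counts the representations x = a - b. *)
Definition corr f g x := \sum_y f (x + y) * g y.

Lemma indic_ge0 A x : 0 <= indic A x. Proof. exact: ler0n. Qed.

Lemma indic_sqr A x : indic A x ^+ 2 = indic A x.
Proof. by rewrite /indic; case: (x \in A); rewrite ?expr1n ?expr0n. Qed.

Lemma sum_indic A : \sum_x indic A x = #|A|%:R.
Proof.
rewrite -sum1_card natr_sum [RHS]big_mkcond /=.
by apply: eq_bigr => x _; rewrite /indic; case: (x \in A).
Qed.

Lemma sum_shift (y : F) f : \sum_x f (x + y) = \sum_x f x.
Proof. by rewrite [RHS](reindex_inj (addIr y)). Qed.

Lemma sum_scale (t : F) f : t != 0 -> \sum_x f (t * x) = \sum_x f x.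
Proof. by move=> t0; rewrite [RHS](reindex_inj (mulfI t0)). Qed.

Lemma corr_ge0 f g x : (forall y, 0 <= f y) -> (forall y, 0 <= g y) -> 0 <= corr f g x.
Proof. by move=> f0 g0; apply: sumr_ge0 => y _; rewrite mulr_ge0. Qed.

Lemma sum_corr f g : \sum_x corr f g x = (\sum_x f x) * \sum_x g x.
Proof.
rewrite /corr exchange_big mulr_sumr; apply: eq_bigr => y _ /=.
by rewrite -mulr_suml sum_shift.
Qed.

Lemma sum_corr_weight k g h :
  \sum_c \sum_d g c * h d * k (c - d) = \sum_x k x * corr g h x.
Proof.
under [RHS]eq_bigr do rewrite mulr_sumr.
rewrite exchange_big [RHS]exchange_big /=; apply: eq_bigr => d _.
rewrite -(sum_shift d); apply: eq_bigr => x _; rewrite addrK; ring.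
Qed.

Lemma sum_corr_shift f g y z : \sum_c f (c + y) * g (c + z) = corr f g (y - z).
Proof.
rewrite /corr -[RHS](sum_shift z); apply: eq_bigr => c _.
by congr (f _ * _); ring.
Qed.

(** Both sides count weighted solutions of a - b = c - d. *)
Lemma sum_corr_corr f g : \sum_x corr f f x * corr g g x = \sum_x corr f g x ^+ 2.
Proof.
rewrite -sum_corr_weight; symmetry.
transitivity (\sum_y \sum_c \sum_d f (y + c) * g c * (f (y + d) * g d)).
  by apply: eq_bigr => y _; rewrite expr2 /corr big_distrlr.
rewrite exchange_big /=; apply: eq_bigr => c _.
rewrite exchange_big /=; apply: eq_bigr => d _.
rewrite -sum_corr_shift mulr_sumr; apply: eq_bigr => y _; ring.
Qed.

End Correlation.

Section UnityRoots.
Variables (F : finFieldType) (T : nat).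

Definition unity_roots : {set F} := [set x | x ^+ T == 1].

Hypotheses (T_gt0 : (0 < T)%N) (card_unity : #|unity_roots| = T).

Lemma unity_neq0 g : g \in unity_roots -> g != 0.
Proof.
rewrite inE; apply: contraTneq => ->.
by rewrite expr0n gtn_eqF // eq_sym oner_eq0.
Qed.

Lemma unity_mul g x : g \in unity_roots -> (g * x \in unity_roots) = (x \in unity_roots).
Proof. by rewrite !inE exprMn => /eqP->; rewrite mul1r. Qed.

Definition unity_inv (X : Type) (f : F -> X) :=
  forall g x, g \in unity_roots -> f (g * x) = f x.

Variable R : realFieldType.
Implicit Types f g : F -> R.
Local Notation S := (indic R unity_roots).
Local Notation r := (corr S S).

Lemma indic_unity_inv (A : {set F}) :
  unity_inv (fun x => x \in A) -> unity_inv (indic R A).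
Proof. by move=> invA g x /invA gx; rewrite /indic gx. Qed.

Lemma unity_inv_unity : unity_inv S.
Proof. by apply: indic_unity_inv => g x; apply: unity_mul. Qed.

Lemma corr_unity_inv f g : unity_inv f -> unity_inv g -> unity_inv (corr f g).
Proof.
move=> invf invg t x tS; rewrite /corr -(sum_scale _ (unity_neq0 tS)).
by apply: eq_bigr => y _; rewrite -mulrDr invf // invg.
Qed.

(** Let H(y, c) be the sum over x in mu of g(x-y) S(c+x).  Invariance under mu makes
the sum of g(x-y) over y in mu independent of x in mu, so the sum of H(y, c) over
y in mu is a constant multiple of r(c).  Cauchy-Schwarz in y bounds E from above
by the sum of the squares of H(y, c), which is the trace of the product of the
kernels g, r, g on mu.  A second Cauchy-Schwarz separates r from the number of
translates of a triple (0, a, b) inside mu, whose second moment is E3. *)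
Lemma operator_inequality g : unity_inv g ->
  (\sum_x g x * r x) ^+ 4 * (\sum_x r x ^+ 2) ^+ 2 <=
  T%:R ^+ 6 * (\sum_x r x ^+ 3) *
  (\sum_a \sum_b g a ^+ 2 * g b ^+ 2 * r (a - b) ^+ 2).
Proof.
move=> invg; set sigma := \sum_x g x * r x; set E := \sum_x r x ^+ 2.
set E3 := \sum_x _ ^+ 3; set W := \sum_a _.
(* the common value, over x in mu, of the sum of g (x - y) over y in mu *)
pose s1 := \sum_y S y * g (1 - y).
have s1E x : S x * (\sum_y S y * g (x - y)) = S x * s1.
  rewrite {1 3}/indic; case: (boolP (x \in _)) => [xS|]; last by rewrite !mul0r.
  congr (_ * _); rewrite -(sum_scale _ (unity_neq0 xS)); apply: eq_bigr => y _.
  by rewrite unity_inv_unity // -{1}[x]mulr1 -mulrBr invg.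
have sigmaE : sigma = T%:R * s1.
  rewrite /sigma -sum_corr_weight -card_unity -(sum_indic R) mulr_suml.
  apply: eq_bigr => x _; rewrite -s1E mulr_sumr.
  by apply: eq_bigr => y _; rewrite mulrA.
pose H y c := \sum_x S x * g (x - y) * S (c + x).
have sumH c : \sum_y S y * H y c = s1 * r c.
  under eq_bigr do rewrite mulr_sumr.
  rewrite exchange_big /= /corr mulr_sumr; apply: eq_bigr => x _.
  transitivity (S (c + x) * (S x * \sum_y S y * g (x - y))); last by rewrite s1E; ring.
  by rewrite !mulr_sumr; apply: eq_bigr => y _; ring.
have CS1 c : (s1 * r c) ^+ 2 <= T%:R * \sum_y S y * H y c ^+ 2.
  have := cauchy_schwarz_sum (fun=> 1) (H ^~ c) (@indic_ge0 R _ unity_roots).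
  under eq_bigr do rewrite mulr1.
  under [X in _ <= X * _ -> _]eq_bigr do rewrite expr1n mulr1.
  by rewrite sum_indic card_unity sumH.
(* the number of translates of the triple (0, a, b) contained in mu *)
pose C a b := \sum_y S y * S (a + y) * S (b + y).
have sumH2 : \sum_c \sum_y S y * H y c ^+ 2 = \sum_a \sum_b (g a * g b * r (a - b)) * C a b.
  transitivity (\sum_y \sum_x \sum_z S y * S x * S z * g (x - y) * g (z - y) * r (x - z)).
    rewrite exchange_big; apply: eq_bigr => y _ /=.
    transitivity (\sum_c \sum_x \sum_z S y * S x * S z * g (x - y) * g (z - y) * (S (c + x) * S (c + z))).
      apply: eq_bigr => c _; rewrite expr2 /H big_distrlr /= mulr_sumr.
      apply: eq_bigr => x _; rewrite mulr_sumr; apply: eq_bigr => z _; ring.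
    rewrite exchange_big; apply: eq_bigr => x _ /=.
    rewrite exchange_big; apply: eq_bigr => z _ /=.
    by rewrite -mulr_sumr sum_corr_shift.
  transitivity (\sum_y \sum_a \sum_b g a * g b * r (a - b) * (S y * S (a + y) * S (b + y))).
    apply: eq_bigr => y _; rewrite -(sum_shift y); apply: eq_bigr => a _.
    rewrite -(sum_shift y); apply: eq_bigr => b _.
    have -> : a + y - (b + y) = a - b by ring.
    rewrite !addrK; ring.
  rewrite exchange_big; apply: eq_bigr => a _ /=.
  rewrite exchange_big; apply: eq_bigr => b _ /=.
  by rewrite -mulr_sumr.
have sumC2 : \sum_a \sum_b C a b ^+ 2 = E3.
  transitivity (\sum_y \sum_y' S y * S y' * (r (y - y')) ^+ 2); last first.
    rewrite (sum_corr_weight (fun x => r x ^+ 2)); apply: eq_bigr => x _.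
    by rewrite -exprSr.
  transitivity (\sum_y \sum_y' \sum_a \sum_b (S y * S y') *
     ((S (a + y) * S (a + y')) * (S (b + y) * S (b + y')))).
    transitivity (\sum_a \sum_b \sum_y \sum_y' (S y * S y') *
       ((S (a + y) * S (a + y')) * (S (b + y) * S (b + y')))).
      apply: eq_bigr => a _; apply: eq_bigr => b _.
      rewrite expr2 /C big_distrlr /=; apply: eq_bigr => y _; apply: eq_bigr => y' _; ring.
    under eq_bigr do rewrite exchange_big /=.
    rewrite exchange_big /=; apply: eq_bigr => y _.
    under eq_bigr do rewrite exchange_big /=.
    by rewrite exchange_big.
  apply: eq_bigr => y _; apply: eq_bigr => y' _.
  rewrite expr2 -sum_corr_shift big_distrlr /= mulr_sumr; apply: eq_bigr => a _.
  by rewrite mulr_sumr.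
have CS2 : (\sum_a \sum_b (g a * g b * r (a - b)) * C a b) ^+ 2 <= W * E3.
  rewrite -sumC2 /W !pair_big /=.
  have := @cauchy_schwarz_sum R (F * F)%type (fun=> 1)
    (fun i => g i.1 * g i.2 * r (i.1 - i.2)) (fun i => C i.1 i.2) (fun=> ler01) => /=.
  under eq_bigr do rewrite mul1r.
  under [X in _ <= X * _ -> _]eq_bigr do rewrite mul1r !exprMn.
  by under [X in _ <= _ * X -> _]eq_bigr do rewrite mul1r.
have s1E2 : s1 ^+ 2 * E <= T%:R * \sum_a \sum_b (g a * g b * r (a - b)) * C a b.
  rewrite -sumH2 /E !mulr_sumr; apply: ler_sum => c _.
  by rewrite -exprMn CS1.
have E0 : 0 <= E by apply: sumr_ge0 => x _; rewrite sqr_ge0.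
have : (s1 ^+ 2 * E) ^+ 2 <= T%:R ^+ 2 * (W * E3).
  apply: le_trans (_ : (T%:R * \sum_a \sum_b (g a * g b * r (a - b)) * C a b) ^+ 2 <= _).
    have A0 : 0 <= s1 ^+ 2 * E by rewrite mulr_ge0 ?sqr_ge0.
    by rewrite lerXn2r // nnegrE // (le_trans A0).
  by rewrite exprMn ler_wpM2l // sqr_ge0.
move=> main; rewrite sigmaE.
have -> : (T%:R * s1) ^+ 4 * E ^+ 2 = T%:R ^+ 4 * (s1 ^+ 2 * E) ^+ 2 :> R by ring.
have -> : T%:R ^+ 6 * E3 * W = T%:R ^+ 4 * (T%:R ^+ 2 * (W * E3)) :> R by ring.
by rewrite ler_wpM2l // exprn_ge0.
Qed.
End UnityRoots.

(** * Third moments of shift counts *)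

Section ShiftCount.
Variables (F : finFieldType) (T : nat).
Hypotheses (T_gt0 : (0 < T)%N) (card_unity : #|unity_roots F T| = T).
Local Notation mu := (unity_roots F T).

Definition shift_count (A : {set F}) (x : F) : nat :=
  #|[set y in A | x + y \in mu]|.

Lemma corr_indic (R : realFieldType) (A : {set F}) x :
  corr (indic R mu) (indic R A) x = (shift_count A x)%:R.
Proof.
rewrite /shift_count -sum1_card natr_sum [RHS]big_mkcond /=.
apply: eq_bigr => y _; rewrite /indic !inE.
by case: (y \in A) => /=; rewrite ?mulr0 ?mulr1 //; case: ifP.
Qed.

Lemma shift_count_le (A : {set F}) x : (shift_count A x <= T)%N.
Proof.
rewrite -[leqRHS]card_unity /shift_count -(card_imset _ (addrI x)).
apply: subset_leq_card; apply/subsetP => _ /imsetP[y + ->].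
by rewrite inE => /andP[].
Qed.

Definition power_image (A : {set F}) : {set F} := [set y ^+ T | y in A].

Lemma mem_power_image (A : {set F}) z : 0 \notin A ->
  unity_inv T (fun x => x \in A) -> (z ^+ T \in power_image A) = (z \in A).
Proof.
move=> A0 invA; apply/imsetP/idP => [[y yA zy]|zA]; last by exists z.
have y0 : y != 0 by apply: contraNneq A0 => <-.
have zyT : z / y \in mu by rewrite inE expr_div_n zy divff // expf_neq0.
by have := invA (z / y) y zyT; rewrite divfK // => ->.
Qed.

Lemma card_power_image (A : {set F}) : 0 \notin A ->
  unity_inv T (fun x => x \in A) -> (#|power_image A| * T)%N = #|A|.
Proof.
move=> A0 invA; rewrite -[RHS]sum1_card.
rewrite (partition_big (fun z => z ^+ T) (mem (power_image A))); last first.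
  by move=> z zA; apply: imset_f.
rewrite -sum_nat_const; apply: eq_bigr => u /imsetP[y yA ->].
have y0 : y != 0 by apply: contraNneq A0 => <-.
rewrite sum1_card -[in LHS]card_unity -(card_imset mu (mulIf y0)); apply: eq_card => z.
rewrite unfold_in; apply/imsetP/andP => [[g gT ->]|[zA /eqP zy]].
  have := gT; rewrite inE => /eqP gT1.
  by rewrite exprMn gT1 mul1r eqxx invA.
exists (z / y); last by rewrite divfK.
by rewrite inE expr_div_n zy divff // expf_neq0.
Qed.
End ShiftCount.

Section ThirdMoment.
Variables (p : nat) (T : nat).
Hypothesis p_pr : prime p.
Local Notation F := 'F_p.
Local Notation mu := (unity_roots F T).
Hypotheses (T_gt0 : (0 < T)%N) (card_unity : #|mu| = T).
Variables (B0 c K : nat).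
Hypotheses (B0T : (B0 <= T)%N) (TB0 : (T * B0 <= p)%N) (B0_ge : (17 <= B0)%N).
Hypotheses (c_ge : (2 ^ 23 <= c)%N) (pK : (p < 2 ^ K)%N).

(** Dividing g - y = x by g = x + y turns a representation into the point z = y / g
with 1 - z = x / g, and g is recovered from z and x. *)
Lemma shift_count_le_fiber_count (A : {set F}) x : x != 0 -> 0 \notin A ->
  unity_inv T (fun x => x \in A) ->
  (shift_count T A x <= fiber_count T (power_image T A) (x ^+ T))%N.
Proof.
move=> x0 A0 invA; rewrite /shift_count /fiber_count.
have nz y : x + y \in mu -> x + y != 0 := @unity_neq0 _ _ T_gt0 _.
rewrite -(card_in_imset (f := fun y => y / (x + y))); last first.
  move=> y y'; rewrite !inE => /andP[_ /eqP yT] /andP[_ /eqP y'T] /eqP.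
  have y0 : x + y != 0 by apply: nz; rewrite inE yT.
  have y'0 : x + y' != 0 by apply: nz; rewrite inE y'T.
  rewrite eqr_div // !mulrDr [y' * y]mulrC => /eqP/addIr/(mulIf x0)//.
apply: subset_leq_card; apply/subsetP => _ /imsetP[y + ->].
rewrite !inE => /andP[yA yT]; have y0 : x + y != 0 by apply: nz; rewrite inE.
rewrite mem_power_image // (_ : 1 - _ = x / (x + y)); last by field.
rewrite !expr_div_n (eqP yT) divr1 eqxx andbT.
have := invA (x + y)^-1 y; rewrite mulrC inE exprVn (eqP yT) invr1 eqxx => -> //.
Qed.

(** Each value x^T is taken at most T times, so this is [fiber_count_third_moment]
up to the term x = 0. *)
Lemma shift_count_third_moment (A : {set F}) : A != set0 -> 0 \notin A ->
  unity_inv T (fun x => x \in A) -> (#|A| <= 4 * B0 ^ 2)%N ->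
  (\sum_x shift_count T A x ^ 3 <= 10 * c * K * (T * #|A| ^ 2))%N.
Proof.
move=> An0 A0 invA AB.
have cU := card_power_image card_unity A0 invA.
set U := power_image T A in cU.
have U0 : 0 \notin U.
  apply/imsetP => -[y yA /esym/eqP]; rewrite expf_eq0 T_gt0 /= => /eqP y0.
  by rewrite -y0 yA in A0.
have U_gt0 : (0 < #|U|)%N.
  by have := An0; rewrite -card_gt0 -cU muln_gt0 => /andP[].
have K0 : (0 < K)%N by case: (K) pK => //; have := prime_gt1 p_pr; lia.
rewrite (bigD1 0) //=.
have AT : (T <= #|A|)%N by rewrite -cU leq_pmull.
have zero : (shift_count T A 0%R ^ 3 <= T * #|A| ^ 2)%N.
  apply: leq_trans (_ : T ^ 3 <= _)%N; first by rewrite leq_exp2r // shift_count_le.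
  by rewrite expnS leq_mul2l leq_exp2r // AT orbT.
have nonzero : (\sum_(x : F | x != 0%R) shift_count T A x ^ 3 <=
                T * (9 * c * K * #|A| ^ 2))%N.
  apply: leq_trans (_ : \sum_(x : F | x != 0%R) fiber_count T U (x ^+ T) ^ 3 <= _)%N.
    by apply: leq_sum => x x0; rewrite leq_exp2r // shift_count_le_fiber_count.
  rewrite (partition_big (fun x => x ^+ T) (fun v => v != 0)); last first.
    by move=> x x0; rewrite expf_neq0.
  have := @fiber_count_third_moment p p_pr T U T_gt0 U0 U_gt0 B0 B0T TB0 B0_ge.
  rewrite cU => /(_ AB c K c_ge pK K0) mom.
  apply: leq_trans (leq_mul (leqnn T) mom); rewrite big_distrr; apply: leq_sum => v v0.
  rewrite (eq_bigr (fun=> fiber_count T U v ^ 3)%N); last by move=> x /andP[_ /eqP->].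
  rewrite sum_nat_const leq_mul2r; apply/orP; right.
  apply: leq_trans (card_pow_fiber v T_gt0); apply: subset_leq_card.
  by apply/subsetP => x; rewrite unfold_in inE => /andP[].
apply: leq_trans (leq_add zero nonzero) _.
have c0 : (0 < c)%N by apply: leq_trans c_ge; rewrite expn_gt0.
move: (#|A| ^ 2)%N {zero nonzero} => a.
have : (T * a <= c * K * (T * a))%N by rewrite leq_pmull // muln_gt0 c0.
move=> le_cK; have -> : (10 * c * K * (T * a) = c * K * (T * a) + T * (9 * c * K * a))%N by ring.
by rewrite leq_add2r.
Qed.

Variable R : realFieldType.
Local Notation S := (indic R mu).

Lemma sum_corr_cube_le (A : {set F}) : A != set0 -> 0 \notin A ->
  unity_inv T (fun x => x \in A) -> (#|A| <= 4 * B0 ^ 2)%N ->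
  \sum_x corr S (indic R A) x ^+ 3 <= (10 * c * K)%:R * (T%:R * #|A|%:R ^+ 2).
Proof.
move=> An0 A0 invA AB; have := shift_count_third_moment An0 A0 invA AB.
rewrite -(ler_nat R) natr_sum natrM (natrM _ T) natrX; apply: le_trans.
by apply: ler_sum => x _; rewrite corr_indic natrX.
Qed.

(** Cauchy-Schwarz between the first moment T |A| and the third moment T |A|^2. *)
Lemma sum_corr_sqr_le (A : {set F}) : 0 \notin A ->
  unity_inv T (fun x => x \in A) -> (#|A| <= 4 * B0 ^ 2)%N ->
  (\sum_x corr S (indic R A) x ^+ 2) ^+ 2 <=
  (10 * c * K)%:R * (T%:R ^+ 2 * #|A|%:R ^+ 3).
Proof.
move=> A0 invA AB; have [Ae|An0] := eqVneq A set0.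
  rewrite big1; first by rewrite expr0n /= mulr_ge0 ?mulr_ge0 ?exprn_ge0.
  by move=> x _; rewrite corr_indic /shift_count (_ : [set _ in _ | _] = set0) ?cards0 ?expr0n //; apply/setP => y; rewrite !inE Ae inE.
have corr0 x : 0 <= corr S (indic R A) x by rewrite corr_indic.
have := @cauchy_schwarz_sum R _ _ (fun=> 1) (corr S (indic R A)) corr0 => /=.
under eq_bigr do rewrite mulr1 -expr2.
move=> /le_trans; apply.
under eq_bigr do rewrite expr1n mulr1.
under [X in _ * X <= _]eq_bigr do rewrite -exprS.
rewrite sum_corr !sum_indic card_unity.
have := sum_corr_cube_le An0 A0 invA AB.
have := ler0n R #|A|; have := ler0n R T; move: T%:R #|A|%:R => t a t0 a0.
move=> /(ler_wpM2l (mulr_ge0 t0 a0))/le_trans; apply.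
by rewrite le_eqVlt; apply/orP; left; apply/eqP; ring.
Qed.
End ThirdMoment.

(** * Dyadic levels of the representation function *)

Lemma power_mean4 (R : realFieldType) (I : finType) (a : I -> R) :
  (\sum_i a i) ^+ 4 <= #|I|%:R ^+ 3 * \sum_i a i ^+ 4.
Proof.
have CS (b : I -> R) : (\sum_i b i) ^+ 2 <= #|I|%:R * \sum_i b i ^+ 2.
  have := @cauchy_schwarz_sum R I (fun=> 1) (fun=> 1) b (fun=> ler01) => /=.
  under eq_bigr do rewrite !mul1r.
  under [X in _ <= X * _ -> _]eq_bigr do rewrite expr1n mulr1.
  by under [X in _ <= _ * X -> _]eq_bigr do rewrite mul1r; rewrite sumr_const.
rewrite (exprM _ 2 2).
apply: le_trans (_ : (#|I|%:R * \sum_i a i ^+ 2) ^+ 2 <= _).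
  by rewrite lerXn2r ?nnegrE ?sqr_ge0 // mulr_ge0 // sumr_ge0 // => i _; rewrite sqr_ge0.
have -> : #|I|%:R ^+ 3 * (\sum_i a i ^+ 4) =
  #|I|%:R ^+ 2 * (#|I|%:R * \sum_i (a i ^+ 2) ^+ 2) :> R.
  by under [X in _ = _ * (_ * X)]eq_bigr do rewrite -exprM; ring.
by rewrite exprMn ler_wpM2l // ?sqr_ge0.
Qed.

Section Levels.
Variables (F : finFieldType) (T : nat).
Local Notation mu := (unity_roots F T).
Hypotheses (T_gt0 : (0 < T)%N) (card_unity : #|mu| = T).
Local Notation rn := (shift_count T mu).

Definition dyadic_level i : {set F} :=
  [set x | [&& x != 0, (2 ^ i <= rn x)%N & (rn x < 2 ^ i.+1)%N]].

Definition super_level i : {set F} := [set x | (x != 0) && (2 ^ i <= rn x)%N].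

Lemma shift_count_unity_inv : unity_inv T rn.
Proof.
move=> g x gT; apply/eqP; rewrite -(eqr_nat rat) -!corr_indic; apply/eqP.
by rewrite (corr_unity_inv T_gt0 (unity_inv_unity _) (unity_inv_unity _)).
Qed.

Lemma shift_countN x : rn (- x) = rn x.
Proof.
apply/eqP; rewrite -(eqr_nat rat) -!corr_indic /corr -(sum_shift x).
by apply/eqP; apply: eq_bigr => y _; rewrite mulrC addrCA addNr addr0 addrC.
Qed.

Lemma dyadic_level0 i : 0 \notin dyadic_level i. Proof. by rewrite inE eqxx. Qed.
Lemma super_level0 i : 0 \notin super_level i. Proof. by rewrite inE eqxx. Qed.

Lemma dyadic_level_inv i : unity_inv T (fun x => x \in dyadic_level i).
Proof.
move=> g x gT; rewrite !inE shift_count_unity_inv // mulf_eq0.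
by rewrite (negPf (unity_neq0 T_gt0 gT)).
Qed.

Lemma super_level_inv i : unity_inv T (fun x => x \in super_level i).
Proof.
move=> g x gT; rewrite !inE shift_count_unity_inv // mulf_eq0.
by rewrite (negPf (unity_neq0 T_gt0 gT)).
Qed.

Lemma super_levelN i x : (- x \in super_level i) = (x \in super_level i).
Proof. by rewrite !inE shift_countN oppr_eq0. Qed.

(** Pigeonhole over the K levels that meet the values of r. *)
Lemma exists_dyadic_level K : (forall x, rn x < 2 ^ K)%N -> (0 < K)%N ->
  exists2 i, (i < K)%N &
  (\sum_(x | x != 0%R) rn x ^ 2 <= K * \sum_(x in dyadic_level i) rn x ^ 2)%N.
Proof.
move=> rnK K0; pose a (i : 'I_K) := (\sum_(x in dyadic_level i) rn x ^ 2)%N.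
have [i _ max_i] := @arg_maxnP _ (Ordinal K0) predT a isT.
exists i => //; apply: leq_trans (_ : \sum_(j < K) a j <= _)%N; last first.
  by rewrite -[K in (K * _)%N]card_ord -sum_nat_const; apply: leq_sum => j _; apply: max_i.
under [leqRHS]eq_bigr do rewrite /a big_mkcond.
rewrite exchange_big [leqLHS]big_mkcond; apply: leq_sum => x _ /=.
case: ifP => // x0; have [->//|n0] := posnP (rn x).
have /andP[lo hi] := trunc_log_bounds (isT : (1 < 2)%N) n0.
set j := trunc_log _ _ in lo hi.
have jK : (j < K)%N by rewrite -(ltn_exp2l _ _ (isT : (1 < 2)%N)); apply: leq_ltn_trans lo (rnK x).
by rewrite (bigD1 (Ordinal jK)) //= inE x0 lo hi leq_addr.
Qed.

Section Real.
Variable R : realFieldType.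
Local Notation S := (indic R mu).
Local Notation r := (corr S S).
Variable i : nat.
Local Notation D := (dyadic_level i).
Local Notation Delta := (2%:R ^+ i : R).
Local Notation E3 := (\sum_x r x ^+ 3).
Local Notation E := (\sum_x r x ^+ 2).

Lemma corr_unity_ge0 x : 0 <= r x. Proof. by rewrite corr_indic. Qed.

Lemma super_level_moment j k : (2%:R ^+ j) ^+ k * #|super_level j|%:R <= \sum_x r x ^+ k.
Proof.
rewrite -(sum_indic R) mulr_sumr; apply: ler_sum => x _; rewrite /indic inE.
have := corr_unity_ge0 x; rewrite corr_indic => r0.
case: (x != 0); last by rewrite mulr0 exprn_ge0.
have [lo|] := leqP (2 ^ j)%N (rn x); last by rewrite mulr0 exprn_ge0.
by rewrite mulr1 lerXn2r // ?nnegrE ?exprn_ge0 // -natrX ler_nat.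
Qed.

Lemma dyadic_level_sub : D \subset super_level i.
Proof. by apply/subsetP => x; rewrite !inE => /and3P[-> ->]. Qed.

Lemma dyadic_level_moment k : Delta ^+ k * #|D|%:R <= \sum_x r x ^+ k.
Proof.
apply: le_trans (super_level_moment i k).
by rewrite ler_wpM2l ?exprn_ge0 // ler_nat subset_leq_card // dyadic_level_sub.
Qed.

Lemma dyadic_level_ge x : Delta * indic R D x <= indic R D x * r x.
Proof.
rewrite /indic inE; case: and3P => [[_ lo _]|]; last by rewrite mulr0 mul0r.
by rewrite mulr1 mul1r corr_indic -natrX ler_nat.
Qed.

Lemma corr_unity0 : r 0 = T%:R.
Proof.
rewrite /corr -[in RHS]card_unity -(sum_indic R); apply: eq_bigr => y _.
by rewrite add0r -expr2 indic_sqr.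
Qed.

Lemma corr_level0 : corr (indic R D) (indic R D) 0 = #|D|%:R.
Proof.
by rewrite /corr -(sum_indic R); apply: eq_bigr => y _; rewrite add0r -expr2 indic_sqr.
Qed.

Lemma energy_le_level K : (0 < K)%N ->
  (\sum_(x | x != 0%R) rn x ^ 2 <= K * \sum_(x in D) rn x ^ 2)%N ->
  E <= T%:R ^+ 2 + K%:R * (4%:R * Delta ^+ 2 * #|D|%:R).
Proof.
move=> K0 leK; rewrite (bigD1 0) //= corr_unity0 lerD2l.
apply: le_trans (_ : (K * \sum_(x in D) rn x ^ 2)%:R <= _).
  apply: le_trans (_ : (\sum_(x | x != 0%R) rn x ^ 2)%:R <= _); last by rewrite ler_nat.
  by rewrite natr_sum; apply: ler_sum => x _; rewrite corr_indic natrX.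
rewrite natrM ler_wpM2l // natr_sum -(sum_indic R) mulr_sumr big_mkcond /=.
apply: ler_sum => x _; rewrite /indic inE; case: and3P => [[_ _ hi]|]; last by rewrite mulr0.
have -> : 4%:R * Delta ^+ 2 * 1 = (2%:R ^+ i.+1) ^+ 2 :> R by rewrite (exprS _ i); ring.
by rewrite natrX lerXn2r // ?nnegrE ?exprn_ge0 // -natrX ler_nat ltnW.
Qed.

Definition low_weight x : R := ((x != 0) && (rn x < 2 ^ i.+1)%N)%:R * r x ^+ 2.
Definition high_weight x : R := (x \in super_level i.+1)%:R * r x ^+ 2.

Local Notation W := (\sum_x r x ^+ 2 * corr (indic R D) (indic R D) x).
Local Notation paired phi := (\sum_x phi x * corr (indic R D) (indic R D) x).

Lemma corr_level_ge0 x : 0 <= corr (indic R D) (indic R D) x.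
Proof. by apply: corr_ge0 => y; apply: indic_ge0. Qed.

Lemma level_operator_inequality :
  (Delta * #|D|%:R) ^+ 4 * E ^+ 2 <= T%:R ^+ 6 * E3 * W.
Proof.
have invD : unity_inv T (indic R D) by apply: indic_unity_inv; apply: dyadic_level_inv.
have E0 : 0 <= E by apply: sumr_ge0 => x _; rewrite sqr_ge0.
apply: le_trans (_ : (\sum_x indic R D x * r x) ^+ 4 * E ^+ 2 <= _).
  rewrite ler_wpM2r ?exprn_ge0 // lerXn2r // ?nnegrE ?mulr_ge0 ?exprn_ge0 //.
    by apply: sumr_ge0 => x _; rewrite mulr_ge0 ?corr_unity_ge0 ?indic_ge0.
  by rewrite -(sum_indic R) mulr_sumr; apply: ler_sum => x _; apply: dyadic_level_ge.
apply: le_trans (operator_inequality T_gt0 card_unity invD) _.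
rewrite -(sum_corr_weight (fun x => r x ^+ 2)) le_eqVlt; apply/orP; left; apply/eqP.
by congr (_ * _); apply: eq_bigr => a _; apply: eq_bigr => b _; rewrite !indic_sqr.
Qed.

(** The differences x = a - b are split into x = 0, where r = T, those with
r < 2 Delta and those with r >= 2 Delta. *)
Lemma level_weight_split :
  W = T%:R ^+ 2 * #|D|%:R + paired low_weight + paired high_weight.
Proof.
rewrite (bigD1 0) //= corr_unity0 corr_level0 -addrA; congr (_ + _).
rewrite big_mkcond -big_split /=; apply: eq_bigr => x _.
rewrite /low_weight /high_weight !inE; case: (x != 0); last by rewrite !mul0r addr0.
by rewrite ltnNge; case: (_ <= _)%N; rewrite /= ?mul1r ?mul0r ?addr0 ?add0r.
Qed.

Lemma low_weight_ge0 x : 0 <= low_weight x.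
Proof. by rewrite mulr_ge0 // sqr_ge0. Qed.

Lemma high_weight_ge0 x : 0 <= high_weight x.
Proof. by rewrite mulr_ge0 // sqr_ge0. Qed.

Lemma paired_low_le :
  paired low_weight <= 2%:R * Delta * \sum_x corr S (indic R D) x ^+ 2.
Proof.
rewrite -sum_corr_corr mulr_sumr; apply: ler_sum => x _.
rewrite mulrA ler_wpM2r ?corr_level_ge0 // /low_weight.
have r0 := corr_unity_ge0 x; case: andP => [[_ hi]|]; last by rewrite mul0r !mulr_ge0 // exprn_ge0.
rewrite mul1r expr2 ler_wpM2r // -exprS [r x]corr_indic -natrX ler_nat; exact: ltnW.
Qed.

(** On D one has Delta <= r, so one of the two indicators of D may be replaced by
r / Delta.  The sum then counts solutions of s - t = x + y with s, t in mu, y in D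
and x in the level set, and Cauchy-Schwarz separates x from y. *)
Lemma paired_super_level_le j :
  (Delta * paired (indic R (super_level j))) ^+ 2 <=
  (\sum_x corr S (indic R D) x ^+ 2) * (\sum_x corr S (indic R (super_level j)) x ^+ 2).
Proof.
set C := super_level j.
have le1 : Delta * paired (indic R C) <= \sum_s corr S (indic R D) s * corr S (indic R C) s.
  apply: le_trans (_ : \sum_x \sum_y indic R C x * indic R D y * r (x + y) <= _).
    rewrite mulr_sumr; apply: ler_sum => x _; rewrite mulrA [Delta * _]mulrC -mulrA.
    rewrite /(corr (indic R D)) mulr_sumr mulr_sumr; apply: ler_sum => y _.
    rewrite -mulrA ler_wpM2l ?indic_ge0 // mulrA mulrC ler_wpM2l ?indic_ge0 //.
    apply: le_trans (dyadic_level_ge _) _.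
    by rewrite /indic; case: (_ \in D); rewrite ?mul1r ?mul0r // corr_unity_ge0.
  have rE x y : r (x + y) = \sum_s S (s + y) * S (s - x).
    by rewrite sum_corr_shift opprK addrC.
  under eq_bigr do under eq_bigr do rewrite rE mulr_sumr.
  under eq_bigr do rewrite exchange_big.
  rewrite exchange_big /=; apply: ler_sum => s _.
  rewrite le_eqVlt; apply/orP; left; apply/eqP.
  have -> : corr S (indic R C) s = \sum_x S (s - x) * indic R C x.
    rewrite /corr (reindex_inj oppr_inj); apply: eq_bigr => x _.
    by rewrite /indic super_levelN.
  rewrite mulrC big_distrlr; apply: eq_bigr => x _; apply: eq_bigr => y _ /=; ring.
have n0 : 0 <= Delta * paired (indic R C).
  rewrite mulr_ge0 ?exprn_ge0 //; apply: sumr_ge0 => x _.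
  by rewrite mulr_ge0 ?corr_level_ge0 ?indic_ge0.
apply: le_trans (_ : (\sum_s corr S (indic R D) s * corr S (indic R C) s) ^+ 2 <= _).
  by rewrite lerXn2r // nnegrE // (le_trans n0).
have := @cauchy_schwarz_sum R _ (fun=> 1) (corr S (indic R D)) (corr S (indic R C)) (fun=> ler01) => /=.
under eq_bigr do rewrite mul1r.
under [X in _ <= X * _ -> _]eq_bigr do rewrite mul1r.
by under [X in _ <= _ * X -> _]eq_bigr do rewrite mul1r.
Qed.

Lemma paired_high_le K : (forall x, rn x < 2 ^ K)%N ->
  paired high_weight <=
  \sum_(j < K) (i < j)%:R * (4%:R * (2%:R ^+ j) ^+ 2 * paired (indic R (super_level j))).
Proof.
move=> rnK.
have pt x : high_weight x <=
    \sum_(j < K) (i < j)%:R * (4%:R * (2%:R ^+ j) ^+ 2 * indic R (super_level j) x).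
  have t0 j : 0 <= (i < j)%:R * (4%:R * (2%:R ^+ j) ^+ 2 * indic R (super_level j) x).
    by rewrite !mulr_ge0 ?exprn_ge0 ?indic_ge0.
  rewrite /high_weight inE; case: andP => [[x0 hi]|_]; last first.
    by rewrite mul0r; apply: sumr_ge0 => j _.
  have n0 : (0 < rn x)%N by apply: leq_trans hi; rewrite expn_gt0.
  have /andP[lo up] := trunc_log_bounds (isT : (1 < 2)%N) n0.
  set j := trunc_log _ _ in lo up.
  have jK : (j < K)%N by rewrite -(ltn_exp2l _ _ (isT : (1 < 2)%N)); apply: leq_ltn_trans lo (rnK x).
  have ij : (i < j)%N.
    by rewrite -ltnS -(ltn_exp2l _ _ (isT : (1 < 2)%N)); apply: leq_ltn_trans up.
  rewrite (bigD1 (Ordinal jK)) //= -[leLHS]addr0 lerD //; last by apply: sumr_ge0 => k _.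
  rewrite ij /indic inE x0 lo !mul1r mulr1 corr_indic.
  have -> : 4%:R * (2%:R ^+ j) ^+ 2 = (2%:R ^+ j.+1) ^+ 2 :> R by rewrite (exprS _ j); ring.
  by rewrite lerXn2r // ?nnegrE ?exprn_ge0 // -natrX ler_nat ltnW.
apply: le_trans (_ : \sum_x (\sum_(j < K) (i < j)%:R * (4%:R * (2%:R ^+ j) ^+ 2 *
    indic R (super_level j) x)) * corr (indic R D) (indic R D) x <= _).
  by apply: ler_sum => x _; rewrite ler_wpM2r ?corr_level_ge0.
under eq_bigr do rewrite mulr_suml.
rewrite exchange_big; apply: ler_sum => j _ /=.
by rewrite !mulr_sumr le_eqVlt; apply/orP; left; apply/eqP; apply: eq_bigr => x _; ring.
Qed.

End Real.
End Levels.

(** * Fourier analysis on the additive group *)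

Section ComplexModulus.
Variable R : realType.
Local Open Scope complex_scope.
Implicit Types z w : R[i].

Definition cabs z : R := complex.Re `|z|.

Lemma cabsE z : `|z| = (cabs z)%:C.
Proof. by rewrite /cabs normc_def. Qed.

Lemma cabs_ge0 z : 0 <= cabs z.
Proof. by rewrite /cabs normc_def sqrtr_ge0. Qed.

Lemma cabsM z w : cabs (z * w) = cabs z * cabs w.
Proof. by apply: complexI; rewrite rmorphM -!cabsE normrM. Qed.

Lemma cabs_real (x : R) : cabs x%:C = `|x|.
Proof. by rewrite /cabs normc_def /= expr0n addr0 sqrtr_sqr. Qed.

Lemma cabs_sqr z : (cabs z ^+ 2)%:C = z * z^*%C.
Proof. by rewrite rmorphXn /= -cabsE sqr_normc. Qed.

Lemma cabs_conj z : cabs z^*%C = cabs z.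
Proof. by rewrite /cabs normcJ. Qed.

Lemma cabs_sum (I : finType) (P : pred I) (f : I -> R[i]) :
  cabs (\sum_(i | P i) f i) <= \sum_(i | P i) cabs (f i).
Proof.
rewrite -lecR -cabsE rmorph_sum; apply: le_trans (ler_norm_sum _ _ _) _.
by rewrite le_eqVlt; apply/orP; left; apply/eqP; apply: eq_bigr => i _; rewrite cabsE.
Qed.
End ComplexModulus.

Section AdditiveCharacter.
Variables (R : realType) (p : nat).
Hypothesis p_pr : prime p.
Local Notation F := 'F_p.
Local Open Scope complex_scope.

Record additive_character (psi : F -> R[i]) : Prop := AdditiveCharacter {
  addcharD : forall x y, psi (x + y) = psi x * psi y;
  addchar_conj : forall x, (psi x)^*%C = psi (- x);
  addchar_sum : forall x, \sum_y psi (y * x) = if x == 0 then p%:R else 0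
}.

(** psi(x) = z^x for a root z of 1 + X + ... + X^(p-1). *)
Lemma exists_additive_character : exists psi, additive_character psi.
Proof.
have p1 := prime_gt1 p_pr.
have [z rz] : exists z : R[i], root (\sum_(i < p) 'X^i) z.
  apply/closed_rootP; rewrite (_ : \sum_(i < p) 'X^i = \poly_(i < p) 1 :> {poly R[i]}).
    by rewrite size_poly_eq ?oner_eq0 // gtn_eqF.
  by rewrite poly_def; apply: eq_bigr => i _; rewrite scale1r.
have sz : \sum_(i < p) z ^+ i = 0.
  move: rz; rewrite rootE horner_sum => /eqP rz; rewrite -[RHS]rz.
  by apply: eq_bigr => i _; rewrite hornerXn.
have zp : z ^+ p = 1 by apply/eqP; rewrite -subr_eq0 subrX1 sz mulr0.
have z1 : z != 1.
  apply: contra_eq_neq sz => ->; under eq_bigr do rewrite expr1n.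
  by rewrite sumr_const card_ord pnatr_eq0; lia.
pose psi (x : F) : R[i] := z ^+ x.
have psiD x y : psi (x + y) = psi x * psi y.
  have zp' : z ^+ (Zp_trunc (pdiv p)).+2 = 1 by rewrite Fp_cast.
  by rewrite /psi -exprD /= expr_mod.
have psi0 : psi 0 = 1 by rewrite /psi expr0.
have sum0 : \sum_y psi y = 0.
  have : (z - 1) * \sum_y psi y = 0.
    rewrite mulrBl mul1r; apply/eqP; rewrite subr_eq0; apply/eqP.
    rewrite [RHS](reindex_inj (addrI 1)) mulr_sumr; apply: eq_bigr => y _.
    by rewrite psiD {2}/psi /= modn_small ?expr1.
  by move/eqP; rewrite mulf_eq0 subr_eq0 (negPf z1) => /eqP.
exists psi; split => // [x|x].
- have zx : `|psi x| = 1.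
    rewrite normrX; have : `|z| ^+ p = 1 by rewrite -normrX zp normr1.
    by move/eqP; rewrite pexpr_eq1 ?normr_ge0 ?prime_gt0 // => /eqP->; rewrite expr1n.
  have nx : psi x != 0 by rewrite -normr_eq0 zx oner_eq0.
  apply: (mulfI nx); rewrite -psiD subrr psi0 -sqr_normc zx expr1n //.
- have [->|x0] := eqVneq x 0.
    under eq_bigr do rewrite mulr0 psi0.
    by rewrite sumr_const card_Fp.
  by rewrite -[RHS]sum0 [RHS](reindex_inj (mulIf x0)).
Qed.
End AdditiveCharacter.

Section Fourier.
Variables (R : realType) (p : nat).
Hypothesis p_pr : prime p.
Local Notation F := 'F_p.
Local Open Scope complex_scope.
Variable psi : F -> R[i].
Hypothesis psiP : additive_character psi.
Implicit Types f g h : F -> R.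

Definition hat f xi : R[i] := \sum_x (f x)%:C * psi (x * xi).
Definition hatabs f xi : R := cabs (hat f xi).

Lemma hatabs_ge0 f xi : 0 <= hatabs f xi. Proof. exact: cabs_ge0. Qed.

Lemma hat_conj f xi : (hat f xi)^*%C = \sum_x (f x)%:C * psi (- (x * xi)).
Proof.
rewrite /hat rmorph_sum; apply: eq_bigr => x _.
by rewrite rmorphM; congr (_ * _); [exact: conjc_real|exact: addchar_conj].
Qed.

Lemma hat0 f : hat f 0 = (\sum_x f x)%:C.
Proof.
rewrite /hat rmorph_sum; apply: eq_bigr => x _; rewrite mulr0.
have := addcharD psiP 0 0; rewrite addr0 => /eqP; rewrite -subr_eq0 -{1}[psi 0]mulr1 -mulrBr.
rewrite mulf_eq0 => /orP[/eqP psi0|]; last by rewrite subr_eq0 => /eqP <-; rewrite mulr1.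
have := addchar_sum psiP 0; rewrite eqxx; under eq_bigr do rewrite mulr0 psi0.
by rewrite big1 // => /esym/eqP; rewrite pnatr_eq0; have := prime_gt0 p_pr; lia.
Qed.

Lemma parseval f g :
  \sum_xi hat f xi * (hat g xi)^*%C = p%:R * (\sum_x f x * g x)%:C.
Proof.
under eq_bigr do rewrite hat_conj /hat big_distrlr.
rewrite exchange_big rmorph_sum mulr_sumr; apply: eq_bigr => x _ /=.
rewrite exchange_big (bigD1 x) //= [X in _ + X]big1 ?addr0.
  have psiE xi : (f x)%:C * psi (x * xi) * ((g x)%:C * psi (- (x * xi))) =
      (f x)%:C * (g x)%:C * psi (xi * 0).
    by rewrite mulr0 -[in RHS](subrr (x * xi)) addcharD //; ring.
  under eq_bigr do rewrite psiE.
  by rewrite -mulr_sumr addchar_sum // eqxx rmorphM /=; ring.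
move=> y yx.
have psiE xi : (f x)%:C * psi (x * xi) * ((g y)%:C * psi (- (y * xi))) =
    (f x)%:C * (g y)%:C * psi (xi * (x - y)).
  by rewrite mulrBr addcharD // ![xi * _]mulrC; ring.
under eq_bigr do rewrite psiE.
by rewrite -mulr_sumr addchar_sum // subr_eq0 eq_sym (negPf yx) mulr0.
Qed.

Lemma hat_corr f g xi : hat (corr f g) xi = hat f xi * (hat g xi)^*%C.
Proof.
rewrite hat_conj /hat big_distrlr [RHS]exchange_big /=.
transitivity (\sum_x \sum_y ((f (x + y))%:C * (g y)%:C * psi (x * xi))).
  by apply: eq_bigr => x _; rewrite /corr rmorph_sum mulr_suml; apply: eq_bigr => y _; rewrite rmorphM.
rewrite exchange_big; apply: eq_bigr => y _ /=.
rewrite [RHS](reindex_inj (addIr y)); apply: eq_bigr => x _ /=.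
have -> : psi (x * xi) = psi ((x + y) * xi) * psi (- (y * xi)).
  by rewrite -addcharD // mulrDl addrK.
ring.
Qed.

Lemma sum_hatabs_sqr f : \sum_xi hatabs f xi ^+ 2 = p%:R * \sum_x f x ^+ 2.
Proof.
apply: complexI; rewrite rmorphM rmorph_nat rmorph_sum /=.
under eq_bigr do rewrite cabs_sqr.
rewrite parseval; congr (_ * _%:C).
Qed.

Lemma sum_hatabs_exp4 f : \sum_xi hatabs f xi ^+ 4 = p%:R * \sum_x corr f f x ^+ 2.
Proof.
rewrite -sum_hatabs_sqr; apply: eq_bigr => xi _.
by rewrite /hatabs hat_corr cabsM cabs_conj -expr2 -exprM.
Qed.

(** The frequency 0 gives the main term; the remaining ones are bounded by absolute
values. *)
Lemma paired_fourier f g :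
  p%:R * (\sum_x f x * corr g g x) <=
  (\sum_x f x) * (\sum_x g x) ^+ 2 + \sum_(xi | xi != 0) hatabs f xi * hatabs g xi ^+ 2.
Proof.
rewrite addrC -lerBlDr; set A := (X in X <= _).
apply: le_trans (ler_norm _) _; rewrite -cabs_real.
have -> : A%:C = \sum_(xi | xi != 0) hat f xi * (hat (corr g g) xi)^*%C.
  have hat_0 : hat f 0 * (hat (corr g g) 0)^*%C = ((\sum_x f x) * (\sum_x g x) ^+ 2)%:C.
    by rewrite hat_corr !hat0 conjc_real -rmorphM conjc_real -rmorphM -expr2.
  by rewrite /A rmorphB rmorphM rmorph_nat -parseval (bigD1 0) //= hat_0 addrAC subrr add0r.
apply: le_trans (cabs_sum _ _) _; apply: ler_sum => xi _.
by rewrite cabsM cabs_conj hat_corr cabsM cabs_conj -expr2.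
Qed.

Variable T : nat.
Local Notation mu := (unity_roots F T).
Hypotheses (T_gt0 : (0 < T)%N) (card_unity : #|mu| = T).
Local Notation S := (indic R mu).
Local Notation E := (\sum_x corr S S x ^+ 2).

Lemma hat_unity_inv f xi : unity_inv T f ->
  T%:R * hat f xi = \sum_x (f x)%:C * hat S (x * xi).
Proof.
move=> invf; transitivity (\sum_(g : F) (S g)%:C * hat f xi).
  by rewrite -mulr_suml -rmorph_sum sum_indic card_unity /= rmorph_nat.
under [RHS]eq_bigr do rewrite mulr_sumr.
rewrite exchange_big; apply: eq_bigr => g _ /=.
rewrite {1}/indic; case: (boolP (g \in mu)) => gT; last first.
  by rewrite mul0r big1 // => x _; rewrite /indic (negPf gT) mul0r mulr0.
rewrite mul1r /hat [LHS](reindex_inj (mulfI (unity_neq0 T_gt0 gT))).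
apply: eq_bigr => x _; rewrite invf // /indic gT mul1r.
by rewrite mulrA.
Qed.

(** Averaging over mu replaces the character by the transform of mu, so T times the
transform of w a is at most the sum of w a G with G(x) = |hat S(x xi)|.  Two
applications of Cauchy-Schwarz with weight w isolate the fourth moment of G,
which is p E. *)
Lemma hatabs_exp4_le w a xi : xi != 0 ->
  (forall x, 0 <= w x) -> (forall x, 0 <= a x) -> unity_inv T (fun x => w x * a x) ->
  (T%:R * hatabs (fun x => w x * a x) xi) ^+ 4 <=
  (\sum_x w x * a x ^+ 2) ^+ 2 * (\sum_x w x ^+ 2) * (p%:R * E).
Proof.
move=> xi0 w0 a0 inv_wa; pose G x := hatabs S (x * xi).
have le1 : T%:R * hatabs (fun x => w x * a x) xi <= \sum_x w x * a x * G x.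
  have -> : T%:R * hatabs (fun x => w x * a x) xi =
      cabs (T%:R * hat (fun x => w x * a x) xi).
    rewrite cabsM; congr (_ * _); have -> : T%:R = (T%:R : R)%:C by rewrite rmorph_nat.
    by rewrite cabs_real ger0_norm.
  rewrite hat_unity_inv //; apply: le_trans (cabs_sum _ _) _.
  by apply: ler_sum => x _; rewrite cabsM cabs_real ger0_norm ?mulr_ge0.
have G4 : \sum_x G x ^+ 4 = p%:R * E.
  by rewrite -sum_hatabs_exp4 [RHS](reindex_inj (mulIf xi0)).
have swa0 : 0 <= \sum_x w x * a x ^+ 2 by apply: sumr_ge0 => x _; rewrite mulr_ge0 ?sqr_ge0.
have swG0 : 0 <= \sum_x w x * G x ^+ 2 by apply: sumr_ge0 => x _; rewrite mulr_ge0 ?sqr_ge0.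
have n0 : 0 <= T%:R * hatabs (fun x => w x * a x) xi by rewrite mulr_ge0 ?hatabs_ge0.
apply: le_trans (_ : ((\sum_x w x * a x * G x) ^+ 2) ^+ 2 <= _).
  by rewrite -exprM lerXn2r // nnegrE // (le_trans n0).
apply: le_trans (_ : ((\sum_x w x * a x ^+ 2) * (\sum_x w x * G x ^+ 2)) ^+ 2 <= _).
  by rewrite lerXn2r ?nnegrE ?sqr_ge0 ?mulr_ge0 //; apply: cauchy_schwarz_sum.
rewrite exprMn -mulrA ler_wpM2l ?sqr_ge0 // -G4.
have := cauchy_schwarz_sum w (fun x => G x ^+ 2) (fun=> ler01) => /=.
under eq_bigr do rewrite mul1r.
under [X in _ <= X * _ -> _]eq_bigr do rewrite mul1r.
by under [X in _ <= _ * X -> _]eq_bigr do rewrite mul1r -exprM.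
Qed.

Lemma sum_sqr_ge0 f : 0 <= \sum_x f x ^+ 2.
Proof. by apply: sumr_ge0 => x _; rewrite sqr_ge0. Qed.

Lemma root4_bound (x y : R) : 0 <= x -> x ^+ 4 <= y -> x <= Num.sqrt (Num.sqrt y).
Proof.
move=> x0 xy; have -> : x = Num.sqrt (Num.sqrt (x ^+ 4)).
  by rewrite (exprM x 2 2) sqrtr_sqr ger0_norm ?sqr_ge0 // sqrtr_sqr ger0_norm.
by rewrite ler_wsqrtr // ler_wsqrtr.
Qed.

Lemma root4K (y : R) : 0 <= y -> (Num.sqrt (Num.sqrt y)) ^+ 4 = y.
Proof. by move=> y0; rewrite (exprM _ 2 2) !sqr_sqrtr ?sqrtr_ge0. Qed.

(** Uses the supremum of the transform of the weight and Parseval for D; suited to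
weights supported where r is large. *)
Lemma paired_sup_bound w a (D : {set F}) :
  (forall x, 0 <= w x) -> (forall x, 0 <= a x) -> unity_inv T (fun x => w x * a x) ->
  exists2 H : R, 0 <= H /\
  (T%:R * H) ^+ 4 <= #|D|%:R ^+ 4 *
     ((\sum_x w x * a x ^+ 2) ^+ 2 * (\sum_x w x ^+ 2) * (p%:R * E)) &
  p%:R * (\sum_x w x * a x * corr (indic R D) (indic R D) x) <=
    (\sum_x w x * a x) * #|D|%:R ^+ 2 + p%:R * H.
Proof.
move=> w0 a0 inv_wa; pose Y := (\sum_x w x * a x ^+ 2) ^+ 2 * (\sum_x w x ^+ 2) * (p%:R * E).
have Y0 : 0 <= Y.
  by apply: mulr_ge0; apply: mulr_ge0; rewrite ?sqr_ge0 ?sum_sqr_ge0 ?ler0n.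
have T0 : T%:R != 0 :> R by rewrite pnatr_eq0; lia.
pose M := Num.sqrt (Num.sqrt Y) / T%:R.
have M0 : 0 <= M by rewrite divr_ge0 ?sqrtr_ge0.
rewrite -/Y; exists (M * #|D|%:R); first split; first by rewrite mulr_ge0.
  by rewrite /M mulrA [T%:R * _]mulrC divfK // exprMn root4K // mulrC.
apply: le_trans (paired_fourier _ _) _; rewrite sum_indic lerD2l.
apply: le_trans (_ : \sum_xi M * hatabs (indic R D) xi ^+ 2 <= _).
  rewrite [leRHS](bigID (fun xi => xi != 0)) /= -[leLHS]addr0 lerD //.
    apply: ler_sum => xi xi0; rewrite ler_wpM2r ?sqr_ge0 // /M ler_pdivlMr ?ltr0n //.
    rewrite mulrC; apply: root4_bound; first by rewrite mulr_ge0 ?hatabs_ge0.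
    exact: hatabs_exp4_le.
  by apply: sumr_ge0 => xi _; rewrite mulr_ge0 ?sqr_ge0.
rewrite -mulr_sumr sum_hatabs_sqr; under eq_bigr do rewrite indic_sqr.
by rewrite sum_indic mulrCA.
Qed.

(** Uses the supremum of the transform of D and Parseval for the other copy of D and
for f; suited to weights that are small but have large support. *)
Lemma paired_l2_bound f (D : {set F}) : (forall x, 0 <= f x) ->
  unity_inv T (fun x => x \in D) ->
  exists2 L : R, 0 <= L /\
  (T%:R * L) ^+ 4 <= #|D|%:R ^+ 5 * (\sum_x f x ^+ 2) ^+ 2 * (p%:R * E) &
  p%:R * (\sum_x f x * corr (indic R D) (indic R D) x) <=
    (\sum_x f x) * #|D|%:R ^+ 2 + p%:R * L.
Proof.
move=> f0 invD; set d := indic R D.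
pose Y := #|D|%:R ^+ 3 * (p%:R * E) : R.
have Y0 : 0 <= Y.
  by rewrite !mulr_ge0 ?exprn_ge0 ?ler0n ?sum_sqr_ge0.
have T0 : T%:R != 0 :> R by rewrite pnatr_eq0; lia.
have p0 : p%:R != 0 :> R by rewrite pnatr_eq0; have := prime_gt0 p_pr; lia.
pose M := Num.sqrt (Num.sqrt Y) / T%:R.
have M0 : 0 <= M by rewrite divr_ge0 ?sqrtr_ge0.
pose Z := \sum_xi hatabs f xi * hatabs d xi.
have Z0 : 0 <= Z by apply: sumr_ge0 => xi _; rewrite mulr_ge0 ?hatabs_ge0.
have Z2 : Z ^+ 2 <= p%:R ^+ 2 * ((\sum_x f x ^+ 2) * #|D|%:R).
  have := cauchy_schwarz_sum (hatabs f) (hatabs d) (fun=> ler01) => /=.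
  under eq_bigr do rewrite mul1r.
  under [X in _ <= X * _ -> _]eq_bigr do rewrite mul1r.
  under [X in _ <= _ * X -> _]eq_bigr do rewrite mul1r.
  rewrite !sum_hatabs_sqr; under [X in _ <= _ * (_ * X) -> _]eq_bigr do rewrite indic_sqr.
  by rewrite sum_indic mulrACA -expr2.
exists (M * Z / p%:R); first split; first by apply: divr_ge0; [exact: mulr_ge0|exact: ler0n].
  have -> : (T%:R * (M * Z / p%:R)) ^+ 4 = Y * (Z ^+ 2 / p%:R ^+ 2) ^+ 2 :> R.
    rewrite -[in RHS](root4K Y0) /M; field; exact/andP.
  have -> : #|D|%:R ^+ 5 * (\sum_x f x ^+ 2) ^+ 2 * (p%:R * E) =
     Y * ((\sum_x f x ^+ 2) * #|D|%:R) ^+ 2 :> R by rewrite /Y; ring.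
  rewrite ler_wpM2l // lerXn2r ?nnegrE ?divr_ge0 ?sqr_ge0 //.
    by rewrite mulr_ge0 // sumr_ge0 // => x _; rewrite sqr_ge0.
  by rewrite ler_pdivrMr ?exprn_gt0 ?ltr0n ?prime_gt0 // mulrC.
apply: le_trans (paired_fourier _ _) _; rewrite sum_indic lerD2l.
rewrite mulrC divfK // /Z mulr_sumr [leRHS](bigID (fun xi => xi != 0)) /= -[leLHS]addr0.
rewrite lerD //; last first.
  by apply: sumr_ge0 => xi _; apply: mulr_ge0 => //; apply: mulr_ge0; apply: hatabs_ge0.
apply: ler_sum => xi xi0; rewrite expr2 mulrA [leLHS]mulrC.
rewrite ler_wpM2r //; first by apply: mulr_ge0; apply: hatabs_ge0.
rewrite /M ler_pdivlMr ?ltr0n // mulrC.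
apply: root4_bound; first by rewrite mulr_ge0 ?hatabs_ge0.
have inv_d : unity_inv T (fun x => d x * 1).
  by move=> g x gT; rewrite !mulr1; apply: (indic_unity_inv _ invD).
have := @hatabs_exp4_le d (fun=> 1) xi xi0 (@indic_ge0 R _ D) (fun=> ler01) inv_d.
under eq_bigr do rewrite expr1n mulr1.
under [X in _ <= _ * X * _ -> _]eq_bigr do rewrite indic_sqr.
rewrite sum_indic -exprSr /Y (_ : hatabs (fun x => d x * 1) xi = hatabs d xi) //.
by congr cabs; apply: eq_bigr => x _; rewrite mulr1.
Qed.
End Fourier.

(** * From character sums to additive energy *)

Section CharacterSum.
Variables (R : realType) (F : finFieldType).
Local Open Scope complex_scope.
Variable chi : F -> R[i].
Hypotheses (chiP : mult_char chi) (chi_np : nonprincipal chi).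

Lemma chi0 : chi 0 = 0. Proof. by case: chiP. Qed.
Lemma chi1 : chi 1 = 1. Proof. by case: chiP => _ []. Qed.
Lemma chiM x y : chi (x * y) = chi x * chi y. Proof. by case: chiP => _ []. Qed.

Lemma norm_chi x : x != 0 -> `|chi x| = 1.
Proof.
move=> x0; have c0 : chi x != 0.
  apply/eqP => c0; have := chi1; rewrite -(divff x0) chiM c0 mul0r => /esym/eqP.
  by rewrite oner_eq0.
have chiX n : chi (x ^+ n) = chi x ^+ n.
  by elim: n => [|n IH]; rewrite ?chi1 // !exprS chiM IH.
have F1 := finRing_gt1 F.
have : `|chi x| ^+ #|F|.-1 = 1.
  apply: (mulfI (_ : `|chi x| != 0)); first by rewrite normr_eq0.
  rewrite mulr1 -exprS prednK; last by apply: ltnW.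
  by rewrite -normrX -chiX expf_card.
have F2 : (0 < #|F|.-1)%N by rewrite -ltnS prednK // ltnW.
by move/eqP; rewrite pexpr_eq1 ?normr_ge0 // => /eqP.
Qed.

Lemma chi_conj x : (chi x)^*%C = chi x^-1.
Proof.
have [->|x0] := eqVneq x 0; first by rewrite invr0 chi0 conjc0.
have c0 : chi x != 0 by rewrite -normr_eq0 norm_chi ?oner_eq0.
by apply: (mulfI c0); rewrite -sqr_normc norm_chi // -chiM divff // chi1 expr1n.
Qed.

Lemma sum_chi : \sum_x chi x = 0.
Proof.
have [x0 x00 chix0] := chi_np.
have : (chi x0 - 1) * \sum_x chi x = 0.
  rewrite mulrBl mul1r; apply/eqP; rewrite subr_eq0; apply/eqP.
  by rewrite [RHS](reindex_inj (mulfI x00)) mulr_sumr; apply: eq_bigr => x _; rewrite chiM.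
by move/eqP; rewrite mulf_eq0 subr_eq0 (negPf chix0) => /eqP.
Qed.

(** For b and d different from 0 the product chi(b+d) times the conjugate of chi(b) equals
chi(1 + d / b), and 1 + d / b runs over all elements except 1 as b varies. *)
Lemma chi_orthogonality s t :
  \sum_b chi (b + s) * (chi (b + t))^*%C = #|F|%:R * (s == t)%:R - 1.
Proof.
rewrite (reindex_inj (addIr (- t))) /=.
under eq_bigr do rewrite addrNK -addrA [- t + s]addrC.
rewrite (bigD1 0) //= chi0 conjc0 mulr0 add0r.
transitivity (\sum_(b | b != 0) chi (1 + (s - t) * b^-1)).
  apply: eq_bigr => b b0; rewrite chi_conj -chiM; congr (chi _).
  by rewrite mulrDl divff.
have [->|st] := eqVneq s t.
  under eq_bigr do rewrite subrr mul0r addr0 chi1.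
  rewrite sumr_const mulr1 -(natrB _ (ltnW (finRing_gt1 F))); congr _%:R.
  by have := cardC1 (0 : F); rewrite subn1.
have -> : \sum_(b | b != 0) chi (1 + (s - t) * b^-1) = \sum_b chi (1 + (s - t) * b^-1) - 1.
  by rewrite [in RHS](bigD1 0) //= invr0 mulr0 addr0 chi1 addrAC subrr add0r.
have st0 : s - t != 0 by rewrite subr_eq0.
rewrite mulr0 -[in RHS]sum_chi; congr (_ - _).
rewrite [RHS](reindex_inj (addrI 1)) [RHS](reindex_inj (mulfI st0)).
by rewrite [RHS](reindex_inj invr_inj).
Qed.

Variable T : nat.
Local Notation mu := (unity_roots F T).
Hypotheses (T_gt0 : (0 < T)%N) (card_unity : #|mu| = T).
Local Notation S := (indic R mu).

Definition shifted_sum b := \sum_(l in mu) \sum_(m in mu) chi (b + l + m).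

Lemma cabs_shifted_sum_inv g b : g \in mu -> cabs (shifted_sum (g * b)) = cabs (shifted_sum b).
Proof.
move=> gT; have g0 := unity_neq0 T_gt0 gT.
have -> : shifted_sum (g * b) = chi g * shifted_sum b.
  rewrite /shifted_sum (reindex_inj (mulfI g0)) mulr_sumr /=.
  apply: eq_big => [l|l lT]; first by rewrite unity_mul.
  rewrite (reindex_inj (mulfI g0)) mulr_sumr /=.
  apply: eq_big => [m|m mT]; first by rewrite unity_mul.
  by rewrite -!mulrDr chiM.
by rewrite cabsM {1}/cabs norm_chi // mul1r.
Qed.

(** The number of representations of s as a sum of two elements of mu. *)
Definition sum_count (s : F) : R := corr S (fun x => S (- x)) s.

Lemma sum_count_sqr : \sum_s sum_count s ^+ 2 = \sum_x corr S S x ^+ 2.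
Proof.
rewrite /sum_count -[LHS]sum_corr_corr; apply: eq_bigr => x _; rewrite expr2; congr (_ * _).
rewrite /corr [RHS](reindex_inj oppr_inj) [RHS](reindex_inj (addrI x)) /=.
by apply: eq_bigr => y _; rewrite mulrC (_ : x - (x + y) = - y) //; ring.
Qed.

Lemma shifted_sumE b : shifted_sum b = \sum_s (sum_count s)%:C * chi (b + s).
Proof.
rewrite /sum_count /corr; under [RHS]eq_bigr do rewrite rmorph_sum mulr_suml.
rewrite exchange_big (reindex_inj oppr_inj) /= /shifted_sum [LHS]big_mkcond.
apply: eq_bigr => l _; rewrite [RHS](reindex_inj (addrI l)) /=.
case: ifPn => lT; last first.
  by rewrite big1 // => m _; rewrite /indic opprK (negPf lT) mulr0 mul0r.
rewrite big_mkcond; apply: eq_bigr => m _ /=.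
rewrite opprK (_ : l + m - l = m) ?[l + m]addrC ?addrK // [m + l]addrC /indic lT mulr1 addrA.
by case: (m \in mu); rewrite ?mul1r ?mul0r.
Qed.

Lemma sum_shifted_sum_sqr :
  \sum_b cabs (shifted_sum b) ^+ 2 <= #|F|%:R * \sum_x corr S S x ^+ 2.
Proof.
rewrite -sum_count_sqr; apply: (@le_trans _ _ (#|F|%:R * (\sum_s sum_count s ^+ 2) - (\sum_s sum_count s) ^+ 2)); last first.
  by rewrite gerBl sqr_ge0.
rewrite le_eqVlt; apply/orP; left; apply/eqP; apply: complexI.
rewrite rmorph_sum /=; under eq_bigr do rewrite cabs_sqr !shifted_sumE.
transitivity (\sum_s \sum_t (sum_count s)%:C * (sum_count t)%:C *
    (#|F|%:R * (s == t)%:R - 1)).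
  transitivity (\sum_b \sum_s \sum_t (sum_count s)%:C * (sum_count t)%:C *
     (chi (b + s) * (chi (b + t))^*%C)).
    apply: eq_bigr => b _; rewrite rmorph_sum big_distrlr /=.
    apply: eq_bigr => s _; apply: eq_bigr => t _.
    by rewrite rmorphM mulrACA; congr (_ * _ * _); apply: conjc_real.
  rewrite exchange_big; apply: eq_bigr => s _ /=.
  rewrite exchange_big; apply: eq_bigr => t _ /=.
  by rewrite -mulr_sumr chi_orthogonality.
rewrite rmorphB rmorphM rmorphXn rmorph_nat !rmorph_sum expr2 big_distrlr /= mulr_sumr -sumrB.
apply: eq_bigr => s _; rewrite (bigD1 s) //= eqxx mulr1 [in RHS](bigD1 s) //=.
rewrite opprD addrA; congr (_ + _); first by rewrite rmorphXn /=; ring.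
by rewrite -sumrN; apply: eq_bigr => t ts; rewrite eq_sym (negPf ts) mulr0 sub0r mulrN1.
Qed.

(** The modulus of the shifted sum is the same at the T points of the coset of a, so
these alone account for the left-hand side. *)
Lemma shifted_sum_energy a : a != 0 ->
  T%:R * cabs (shifted_sum a) ^+ 2 <= #|F|%:R * \sum_x corr S S x ^+ 2.
Proof.
move=> a0; apply: le_trans sum_shifted_sum_sqr.
rewrite -card_unity -(sum_indic R) mulr_suml [leRHS](reindex_inj (mulIf a0)).
apply: ler_sum => g _ /=; rewrite /indic; case: (boolP (g \in mu)) => gT.
  by rewrite mul1r cabs_shifted_sum_inv.
by rewrite mul0r sqr_ge0.
Qed.
End CharacterSum.

(** * Solving the inequalities for the energy exponent *)

Section Logarithms.
Variable R : realType.

Lemma ln_le (x y : R) : 0 < x -> x <= y -> ln x <= ln y.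
Proof. by move=> x0 xy; rewrite ler_ln ?posrE ?(lt_le_trans x0). Qed.

Lemma ln_mul (x y : R) : 0 < x -> 0 < y -> ln (x * y) = ln x + ln y.
Proof. by move=> x0 y0; rewrite lnM ?posrE. Qed.

Lemma ln_exp (x : R) n : 0 < x -> ln (x ^+ n) = n%:R * ln x.
Proof. by move=> x0; rewrite lnXn // mulr_natl. Qed.

Ltac pos :=
  lazymatch goal with
  | |- is_true (0 < _ * _) => apply: mulr_gt0; [pos|pos]
  | |- is_true (0 < _ ^+ _) => apply: exprn_gt0; pos
  | |- is_true (0 < _%:R) => exact: ltr0Sn
  | _ => assumption
  end.
Ltac take_ln h :=
  let l := fresh "ln_le" in
  match type of h with
  | is_true (?x <= ?y) => assert (l : ln x <= ln y) by (refine (ln_le _ h); pos)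
  end;
  repeat (rewrite ln_mul in l; [|pos|pos]);
  repeat (rewrite ln_exp in l; [|pos]).

Lemma max3_case (W x y z : R) : W <= x + y + z -> 0 < W ->
  [\/ 0 < x /\ W <= 2%:R ^+ 2 * x, 0 < y /\ W <= 2%:R ^+ 2 * y
    | 0 < z /\ W <= 2%:R ^+ 2 * z].
Proof.
move=> Wle W0; have [Wx|xW] := lerP W (2%:R ^+ 2 * x).
  by apply: Or31; split => //; lra.
have [Wy|yW] := lerP W (2%:R ^+ 2 * y).
  by apply: Or32; split => //; lra.
by apply: Or33; split; lra.
Qed.


(** Here t = T, D and d are the height and the size of the dyadic level, Lo and Hi the
two parts of W.  Whichever of the three parts of W dominates, the logarithms of
the hypotheses combine linearly to the conclusion; both Lo and Hi lead to
the exponent 32/13, the diagonal part only to 17/7. *)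
Lemma energy_exponent_case1 (t A k E d D E3 W Lo Hi ED : R) :
  1 <= t -> 1 <= A -> 1 <= k -> 0 < E -> 0 < d -> 0 < D -> 0 <= ED ->
  E <= 2%:R ^+ 3 * k * (D ^+ 2 * d) ->
  D ^+ 3 * d <= E3 -> E3 <= A * t ^+ 3 ->
  (D * d) ^+ 4 * E ^+ 2 <= t ^+ 6 * E3 * W ->
  W <= t ^+ 2 * d + Lo + Hi ->
  Lo <= 2%:R * D * ED -> ED ^+ 2 <= A * (t ^+ 2 * d ^+ 3) ->
  Hi ^+ 4 * D ^+ 5 <= 2%:R ^+ 8 * k ^+ 4 * (A ^+ 2 * t ^+ 4 * d ^+ 3 * E3 ^+ 3) ->
  ln E <= 32%:R / 13%:R * ln t + 20%:R * (ln A + ln k + ln 2%:R).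
Proof.
move=> t1 A1 k1 E0 d0 D0 ED0 hE h3 hE3 op hW hLo hED hHi.
have t0 : 0 < t := lt_le_trans ltr01 t1.
have A0 : 0 < A := lt_le_trans ltr01 A1.
have k0 : 0 < k := lt_le_trans ltr01 k1.
have E30 : 0 < E3 by apply: lt_le_trans h3; pos.
have W0 : 0 < W.
  have : 0 < t ^+ 6 * E3 * W by apply: lt_le_trans op; pos.
  by rewrite pmulr_rgt0 //; pos.
have lt0 : 0 <= ln t by rewrite ln_ge0.
have lA0 : 0 <= ln A by rewrite ln_ge0.
have lk0 : 0 <= ln k by rewrite ln_ge0.
have l20 : 0 <= ln 2%:R :> R by rewrite ln_ge0 // ler1n.
take_ln hE; take_ln h3; take_ln hE3; take_ln op.
have [[_ hX]|[Lo0 hX]|[Hi0 hX]] := max3_case hW W0; take_ln hX.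
- lra.
- have ED_gt0 : 0 < ED.
    rewrite lt0r ED0 andbT; apply: contraTneq Lo0 => ED_0.
    by rewrite -leNgt (le_trans hLo) // ED_0 mulr0.
  by take_ln hLo; take_ln hED; lra.
- by take_ln hHi; lra.
Qed.

(** As in [energy_exponent_case1].  Lo and Hi lead to the first alternative, the main
term E d^2 / P to the second, and the diagonal part to the exponent 17/7, which
is smaller than the first alternative because t^3 <= P^2. *)
Lemma energy_exponent_case2 (t A k P E d D E3 W Lo Hi : R) :
  1 <= t -> 1 <= A -> 1 <= k -> 0 < P -> 0 < E -> 0 < d -> 0 < D ->
  t ^+ 3 <= P ^+ 2 ->
  E <= 2%:R ^+ 3 * k * (D ^+ 2 * d) ->
  D ^+ 3 * d <= E3 -> E3 <= A * t ^+ 3 ->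
  (D * d) ^+ 4 * E ^+ 2 <= t ^+ 6 * E3 * W ->
  W <= (t ^+ 2 * d + E * d ^+ 2 / P) + Lo + Hi ->
  (t * Lo) ^+ 4 <= d ^+ 5 * (2%:R ^+ 2 * D ^+ 2 * E) ^+ 2 * (P * E) ->
  (t * Hi) ^+ 4 * D <= d ^+ 4 * (E3 ^+ 3 * (P * E)) ->
  ln E <= 31%:R / 13%:R * ln t + ln P / 26%:R + 20%:R * (ln A + ln k + ln 2%:R) \/
  ln E <= 3%:R * ln t - ln P / 3%:R + 20%:R * (ln A + ln k + ln 2%:R).
Proof.
move=> t1 A1 k1 P0 E0 d0 D0 htP hE h3 hE3 op hW hLo hHi.
have t0 : 0 < t := lt_le_trans ltr01 t1.
have A0 : 0 < A := lt_le_trans ltr01 A1.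
have k0 : 0 < k := lt_le_trans ltr01 k1.
have E30 : 0 < E3 by apply: lt_le_trans h3; pos.
have W0 : 0 < W.
  have : 0 < t ^+ 6 * E3 * W by apply: lt_le_trans op; pos.
  by rewrite pmulr_rgt0 //; pos.
have lt0 : 0 <= ln t by rewrite ln_ge0.
have lA0 : 0 <= ln A by rewrite ln_ge0.
have lk0 : 0 <= ln k by rewrite ln_ge0.
have l20 : 0 <= ln 2%:R :> R by rewrite ln_ge0 // ler1n.
take_ln htP; take_ln hE; take_ln h3; take_ln hE3; take_ln op.
have [[_ hX]|[Lo0 hX]|[Hi0 hX]] := max3_case hW W0.
- have := hX; rewrite mulrDr => hX'.
  have [h1|h1] := lerP W (2%:R ^+ 3 * (t ^+ 2 * d)).
    by take_ln h1; left; lra.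
  have h2 : W * P <= 2%:R ^+ 3 * (E * d ^+ 2).
    rewrite -ler_pdivlMr // -mulrA; set y := _ / P in hX' *.
    by move: h1 hX'; rewrite !exprS expr0 => h1 hX'; lra.
  by take_ln h2; right; lra.
- by take_ln hX; take_ln hLo; left; lra.
- by take_ln hX; take_ln hHi; left; lra.
Qed.

End Logarithms.

(** * The energy of a multiplicative subgroup *)

Section EnergyBound.
Variables (R : realType) (p T c : nat).
Hypothesis p_pr : prime p.
Local Notation F := 'F_p.
Local Notation mu := (unity_roots F T).
Hypotheses (T_gt0 : (0 < T)%N) (card_unity : #|mu| = T) (c_ge : (2 ^ 23 <= c)%N).
Local Notation S := (indic R mu).
Local Notation r := (corr S S).
Local Notation E := (\sum_x r x ^+ 2).
Local Notation E3 := (\sum_x r x ^+ 3).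

Definition dyadic_range := (trunc_log 2 p).+1.
Local Notation K := dyadic_range.
Local Notation A := ((10 * c * K)%:R : R).
Local Notation loss := (ln A + ln K%:R + ln 2%:R).
Local Notation d i := (#|dyadic_level F T i|%:R : R).

Lemma lt_dyadic_range : (p < 2 ^ K)%N.
Proof. exact: trunc_log_ltn. Qed.

Lemma shift_count_lt x : (shift_count T mu x < 2 ^ K)%N.
Proof.
apply: leq_ltn_trans lt_dyadic_range; apply: leq_trans (max_card _) _.
by rewrite card_Fp.
Qed.

Lemma const_gt0 : (0 < c)%N.
Proof. by apply: leq_trans c_ge; rewrite expn_gt0. Qed.

Lemma moment_const_ge1 : 1 <= A.
Proof. by rewrite ler1n !muln_gt0 const_gt0. Qed.

Lemma dyadic_range_ge1 : 1 <= K%:R :> R. Proof. by rewrite ler1n. Qed.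

Lemma order_ge1 : 1 <= T%:R :> R. Proof. by rewrite ler1n. Qed.

Lemma loss_ge0 : ln 2%:R <= loss.
Proof. by rewrite lerDr addr_ge0 // ln_ge0 ?moment_const_ge1 ?dyadic_range_ge1. Qed.

Lemma ln2_ge0 : 0 <= ln 2%:R :> R. Proof. by rewrite ln_ge0 // ler1n. Qed.

Lemma zero_notin_unity : 0 \notin mu.
Proof. by apply/negP => /(unity_neq0 T_gt0); rewrite eqxx. Qed.

Lemma energy_ge : T%:R ^+ 2 <= E.
Proof.
rewrite (bigD1 0) //= corr_unity0 // lerDl.
by apply: sumr_ge0 => x _; rewrite sqr_ge0.
Qed.

Lemma energy_le_cube : E <= T%:R ^+ 3.
Proof.
apply: le_trans (_ : \sum_x T%:R * r x <= _); last first.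
  by rewrite -mulr_sumr sum_corr !sum_indic card_unity -expr2 -exprS.
apply: ler_sum => x _; rewrite corr_indic expr2 ler_wpM2r // ler_nat.
exact: shift_count_le.
Qed.

Lemma exists_energy_level : 2%:R * T%:R ^+ 2 <= E ->
  exists i, 0 < d i /\ E <= 2%:R ^+ 3 * K%:R * ((2%:R ^+ i) ^+ 2 * d i).
Proof.
move=> bigE; have [i _ iE] := exists_dyadic_level shift_count_lt (isT : (0 < K)%N).
have le_level := energy_le_level card_unity R (isT : (0 < K)%N) iE; exists i.
have hE : E <= 2%:R ^+ 3 * K%:R * ((2%:R ^+ i) ^+ 2 * d i).
  move: bigE le_level; have -> : 2%:R ^+ 3 * K%:R * ((2%:R ^+ i) ^+ 2 * d i) =
    2%:R * (K%:R * (4%:R * (2%:R ^+ i) ^+ 2 * d i)) :> R by ring.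
  by move: (K%:R * _) => y; lra.
split => //; rewrite lt0r ler0n andbT; apply: contraTneq hE => ->.
rewrite !mulr0 -ltNge; apply: lt_le_trans energy_ge.
by rewrite exprn_gt0 // ltr0n.
Qed.

Section ThirdMomentRange.
Variable B0 : nat.
Hypotheses (B0T : (B0 <= T)%N) (TB0 : (T * B0 <= p)%N) (B0_ge : (17 <= B0)%N)
  (TB0_sqr : (T <= 4 * B0 ^ 2)%N).

Lemma unity_third_moment : E3 <= A * T%:R ^+ 3.
Proof.
have mu0 : mu != set0 by rewrite -card_gt0 card_unity.
have := sum_corr_cube_le p_pr T_gt0 card_unity B0T TB0 B0_ge c_ge lt_dyadic_range R mu0 zero_notin_unity.
rewrite card_unity => /(_ (fun g x => @unity_mul F T g x) TB0_sqr).
by rewrite -exprS.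
Qed.

End ThirdMomentRange.

(** Hi is a sum over at most K dyadic levels above D.  The bound for the level 2^j
decays like a power of 2^j, so replacing 2^j by Delta loses nothing but the
number of levels. *)
Lemma paired_high_exp4 i : (T * T <= p)%N -> (17 <= T)%N ->
  (\sum_x high_weight T R i x * corr (indic R (dyadic_level F T i)) (indic R (dyadic_level F T i)) x) ^+ 4
    * (2%:R ^+ i) ^+ 5 <=
  2%:R ^+ 8 * K%:R ^+ 4 * (A ^+ 2 * T%:R ^+ 4 * d i ^+ 3 * E3 ^+ 3).
Proof.
move=> TTp T17; set Hi := \sum_x _; set De := 2%:R ^+ i.
have De0 : 0 <= De ^+ 5 by rewrite !exprn_ge0.
pose N j : R := \sum_x indic R (super_level F T j) x *
   corr (indic R (dyadic_level F T i)) (indic R (dyadic_level F T i)) x.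
pose b (j : 'I_K) : R := (i < j)%:R * (4%:R * (2%:R ^+ j) ^+ 2 * N j).
set M := A ^+ 2 * _ * _ * _.
have E30 : 0 <= E3 by apply: sumr_ge0 => x _; rewrite exprn_ge0 ?corr_unity_ge0.
have M0 : 0 <= M by rewrite !mulr_ge0 ?exprn_ge0.
have Hi0 : 0 <= Hi.
  by apply: sumr_ge0 => x _; rewrite mulr_ge0 ?high_weight_ge0 ?corr_level_ge0.
have Hib : Hi <= \sum_j b j by apply: paired_high_le shift_count_lt.
have small j : (#|super_level F T j| <= 4 * T ^ 2)%N.
  have := super_level_moment F T R j 1; rewrite expr1; under eq_bigr do rewrite expr1.
  rewrite sum_corr !sum_indic card_unity -natrM -natrX -natrM ler_nat => le_C.
  apply: leq_trans (_ : 2 ^ j * #|super_level F T j| <= _)%N.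
    by rewrite leq_pmull // expn_gt0.
  by apply: leq_trans le_C _; rewrite -mulnn leq_pmull.
have sqrC (C : {set F}) : 0 \notin C -> unity_inv T (fun x => x \in C) -> (#|C| <= 4 * T ^ 2)%N ->
    (\sum_x corr S (indic R C) x ^+ 2) ^+ 2 <= A * (T%:R ^+ 2 * #|C|%:R ^+ 3).
  exact: (sum_corr_sqr_le p_pr T_gt0 card_unity (leqnn T) TTp T17 c_ge lt_dyadic_range R).
have b4 j : b j ^+ 4 * De ^+ 5 <= 2%:R ^+ 8 * M.
  rewrite /b; case: ltnP => [ij|_]; last first.
    by rewrite mul0r expr0n mul0r mulr_ge0 ?exprn_ge0.
  rewrite mul1r; set C := super_level F T j; set q : R := 2%:R ^+ j.
  have q0 : 0 <= q by rewrite exprn_ge0.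
  have ND : (De * N j) ^+ 4 <= A * (T%:R ^+ 2 * d i ^+ 3) * (A * (T%:R ^+ 2 * #|C|%:R ^+ 3)).
    apply: le_trans (_ : ((\sum_x corr S (indic R (dyadic_level F T i)) x ^+ 2) *
       (\sum_x corr S (indic R C) x ^+ 2)) ^+ 2 <= _).
      rewrite (exprM _ 2 2) lerXn2r ?nnegrE ?sqr_ge0 //.
        by rewrite mulr_ge0 //; apply: sumr_ge0 => x _; rewrite sqr_ge0.
      exact: paired_super_level_le.
    rewrite exprMn ler_pM ?sqr_ge0 //; apply: sqrC.
    - exact: dyadic_level0.
    - exact: dyadic_level_inv.
    - by apply: leq_trans (small i); apply/subset_leq_card/dyadic_level_sub.
    - exact: super_level0.
    - exact: super_level_inv.
    - exact: small.
  have C3 : q ^+ 8 * #|C|%:R ^+ 3 * De <= E3 ^+ 3.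
    apply: le_trans (_ : (q ^+ 3 * #|C|%:R) ^+ 3 <= _); last first.
      by rewrite lerXn2r ?nnegrE ?mulr_ge0 ?exprn_ge0 //; apply: super_level_moment.
    have -> : (q ^+ 3 * #|C|%:R) ^+ 3 = q ^+ 8 * #|C|%:R ^+ 3 * q :> R by ring.
    rewrite ler_wpM2l ?mulr_ge0 ?exprn_ge0 // /De /q.
    by rewrite ler_weXn2l ?ler1n // ltnW.
  have -> : (4%:R * q ^+ 2 * N j) ^+ 4 * De ^+ 5 = 2%:R ^+ 8 * (q ^+ 8 * De * (De * N j) ^+ 4) :> R.
    by ring.
  rewrite ler_wpM2l ?exprn_ge0 //.
  apply: le_trans (ler_wpM2l _ ND) _; first by rewrite mulr_ge0 ?exprn_ge0.
  have -> : q ^+ 8 * De * (A * (T%:R ^+ 2 * d i ^+ 3) * (A * (T%:R ^+ 2 * #|C|%:R ^+ 3))) =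
    A ^+ 2 * T%:R ^+ 4 * d i ^+ 3 * (q ^+ 8 * #|C|%:R ^+ 3 * De) :> R by ring.
  by rewrite ler_wpM2l // !mulr_ge0 ?exprn_ge0.
apply: le_trans (_ : (\sum_j b j) ^+ 4 * De ^+ 5 <= _).
  by rewrite ler_wpM2r // lerXn2r // nnegrE // (le_trans Hi0).
apply: le_trans (ler_wpM2r De0 (power_mean4 b)) _; rewrite card_ord -[leLHS]mulrA.
have -> : 2%:R ^+ 8 * K%:R ^+ 4 * M = K%:R ^+ 3 * (K%:R * (2%:R ^+ 8 * M)) :> R by ring.
rewrite ler_wpM2l ?exprn_ge0 //.
apply: le_trans (_ : \sum_(j < K) 2%:R ^+ 8 * M <= _).
  by rewrite mulr_suml; apply: ler_sum => j _.
by rewrite sumr_const card_ord mulr_natl.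
Qed.

Lemma energy_bound_small : (T * T <= p)%N ->
  ln E <= 32%:R / 13%:R * ln T%:R + 20%:R * loss.
Proof.
move=> TTp; have t1 := order_ge1; have lt0 : 0 <= ln T%:R :> R by rewrite ln_ge0.
have T0 : 0 < T%:R :> R by rewrite ltr0n.
have E0 : 0 < E by apply: lt_le_trans energy_ge; rewrite exprn_gt0.
have l2 := ln2_ge0; have lA := loss_ge0.
have [T17|T17] := ltnP T 17.
  have : E <= 2%:R ^+ 5 * T%:R ^+ 2.
    apply: le_trans energy_le_cube _; rewrite exprS ler_wpM2r ?exprn_ge0 //.
    by rewrite -natrX ler_nat (leq_trans (ltnW T17)).
  by move=> /(ln_le E0); rewrite ln_mul ?exprn_gt0 // !ln_exp // => h; lra.
have [small|big] := ltrP E (2%:R * T%:R ^+ 2).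
  have := ln_le E0 (ltW small); rewrite ln_mul ?exprn_gt0 // ln_exp // => h; lra.
have [i [d0 hE]] := exists_energy_level big.
have TB : (T <= 4 * T ^ 2)%N by rewrite -mulnn mulnA leq_pmull // muln_gt0.
have h3 := dyadic_level_moment F T R i 3.
have hE3 := unity_third_moment (leqnn T) TTp T17 TB.
have op := level_operator_inequality T_gt0 card_unity R i.
have D0 : 0 < 2%:R ^+ i :> R by rewrite exprn_gt0.
apply: (energy_exponent_case1 t1 moment_const_ge1 dyadic_range_ge1 E0 d0 D0 _ hE h3 hE3 op _
  (paired_low_le F T R i) _ (paired_high_exp4 i TTp T17)).
- by apply: sumr_ge0 => x _; rewrite sqr_ge0.
- by rewrite -level_weight_split.
- apply: (sum_corr_sqr_le p_pr T_gt0 card_unity (leqnn T) TTp T17 c_ge lt_dyadic_range R).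
  + exact: dyadic_level0.
  + exact: dyadic_level_inv.
  + rewrite -(ler_nat R); apply: le_trans (_ : T%:R ^+ 2 <= _).
      have := dyadic_level_moment F T R i 1; rewrite expr1; under eq_bigr do rewrite expr1.
      rewrite sum_corr !sum_indic card_unity -expr2; apply: le_trans.
      by rewrite ler_peMl // exprn_ege1 // ler1n.
    by rewrite -natrX ler_nat leq_pmull.
Qed.

(** Since T^2 >= p, the size of the Stepanov parameter B is limited by p / T rather
than by T. *)
Lemma energy_bound_large : (p <= T * T)%N -> (17 * T <= p)%N -> (T ^ 3 <= p ^ 2)%N ->
  ln E <= 31%:R / 13%:R * ln T%:R + ln p%:R / 26%:R + 20%:R * loss \/
  ln E <= 3%:R * ln T%:R - ln p%:R / 3%:R + 20%:R * loss.
Proof.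
move=> pTT T17 Tp; have t1 := order_ge1; have lt0 : 0 <= ln T%:R :> R by rewrite ln_ge0.
have T0 : 0 < T%:R :> R by rewrite ltr0n.
have P0 : 0 < p%:R :> R by rewrite ltr0n prime_gt0.
have lp0 : 0 <= ln p%:R :> R by rewrite ln_ge0 // ler1n prime_gt0.
have E0 : 0 < E by apply: lt_le_trans energy_ge; rewrite exprn_gt0.
have l2 := ln2_ge0; have lA := loss_ge0.
have [small|big] := ltrP E (2%:R * T%:R ^+ 2).
  by have := ln_le E0 (ltW small); rewrite ln_mul ?exprn_gt0 // ln_exp // => h; left; lra.
have [i [d0 hE]] := exists_energy_level big.
(* the largest Stepanov parameter allowed by T B <= p *)
pose B0 := (p %/ T)%N.
have B0T : (B0 <= T)%N by rewrite -(leq_pmul2r T_gt0) (leq_trans (leq_trunc_div _ _)).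
have TB0 : (T * B0 <= p)%N by rewrite mulnC leq_trunc_div.
have B0_ge : (17 <= B0)%N by rewrite leq_divRL.
have TB : (T <= 4 * B0 ^ 2)%N.
  have pB : (p <= 2 * B0 * T)%N.
    apply: leq_trans (ltnW (ltn_ceil p T_gt0)) _; rewrite -/B0 leq_mul2r.
    by apply/orP; right; rewrite mul2n -addnn -addn1 leq_add2l (leq_trans _ B0_ge).
  rewrite -(@leq_pmul2r (T ^ 2)) ?expn_gt0 ?T_gt0 // -expnS (leq_trans Tp) //.
  rewrite (_ : 4 = 2 ^ 2)%N // -!expnMn leq_exp2r //.
have h3 := dyadic_level_moment F T R i 3.
have hE3 := unity_third_moment B0T TB0 B0_ge TB.
have op := level_operator_inequality T_gt0 card_unity R i.
have D0 : 0 < 2%:R ^+ i :> R by rewrite exprn_gt0.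
have [psi psiP] := exists_additive_character R p_pr.
have r0 x : 0 <= r x by apply: corr_unity_ge0.
have inv_r : unity_inv T r := corr_unity_inv T_gt0 (unity_inv_unity R) (unity_inv_unity R).
have [L [L0 hL] pairedL] := paired_l2_bound p_pr psiP T_gt0 card_unity
  (@low_weight_ge0 F T R i) (dyadic_level_inv T_gt0 i).
pose w x := indic R (super_level F T i.+1) x * r x.
have w0 x : 0 <= w x by rewrite mulr_ge0 ?indic_ge0.
have inv_w : unity_inv T (fun x => w x * r x).
  move=> g x gT; rewrite /w inv_r //.
  by rewrite (indic_unity_inv R (super_level_inv T_gt0 i.+1)).
have [H [H0 hH] pairedH] := paired_sup_bound p_pr psiP T_gt0 card_unity
  (dyadic_level F T i) w0 r0 inv_w.
have wE x : w x * r x = high_weight T R i x by rewrite /w /high_weight -mulrA -expr2.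
have P3 : T%:R ^+ 3 <= p%:R ^+ 2 :> R by rewrite -!natrX ler_nat.
have PE0 : 0 <= p%:R * E by rewrite mulr_ge0 // ltW.
apply: (energy_exponent_case2 t1 moment_const_ge1 dyadic_range_ge1 P0 E0 d0 D0 P3 hE h3 hE3 op (Lo := L) (Hi := H)).
- rewrite level_weight_split //; move: pairedH; under eq_bigr do rewrite wE.
  under [X in _ <= X * _ + _ -> _]eq_bigr do rewrite wE.
  move: pairedL; set lo := \sum_x low_weight T R i x; set hi := \sum_x high_weight T R i x.
  set plo := \sum_x low_weight T R i x * _; set phi := \sum_x high_weight T R i x * _.
  move=> pairedL pairedH.
  have lohi : lo + hi <= E.
    rewrite /lo /hi -big_split; apply: ler_sum => x _ /=.
    rewrite /low_weight /high_weight !inE; case: (x != 0) => /=; last by rewrite !mul0r addr0 sqr_ge0.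
    by rewrite ltnNge; case: (_ <= _)%N => /=; rewrite ?mul0r ?mul1r ?addr0 ?add0r.
  rewrite -!addrA lerD2l.
  have -> : E * d i ^+ 2 / p%:R + (L + H) = (E * d i ^+ 2 + p%:R * L + p%:R * H) / p%:R :> R.
    by field; rewrite gt_eqF.
  rewrite ler_pdivlMr // mulrC mulrDr.
  apply: le_trans (lerD pairedL pairedH) _.
  by rewrite addrACA -mulrDl -[leRHS]addrA lerD2r ler_wpM2r ?exprn_ge0.
- apply: le_trans hL _; rewrite ler_wpM2r // ler_wpM2l ?exprn_ge0 //.
  have low0 : 0 <= \sum_(x : F) low_weight T R i x ^+ 2 by apply: sumr_ge0 => x _; rewrite sqr_ge0.
  rewrite lerXn2r ?nnegrE // ?mulr_ge0 ?exprn_ge0 // ?(ltW E0) // mulr_sumr.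
  apply: ler_sum => x _; rewrite /low_weight; case: andP => [[_ hi]|_]; last first.
    by rewrite mul0r expr0n !mulr_ge0 ?exprn_ge0.
  rewrite mul1r expr2 ler_wpM2r ?sqr_ge0 // -exprMn -exprS.
  rewrite lerXn2r ?nnegrE ?exprn_ge0 // corr_indic -natrX ler_nat; exact: ltnW.
- have E30 : 0 <= E3 by apply: sumr_ge0 => x _; rewrite exprn_ge0.
  apply: le_trans (ler_wpM2r (ltW D0) hH) _.
  set X := \sum_x w x * r x ^+ 2; set Y := \sum_x w x ^+ 2.
  have X0 : 0 <= X by apply: sumr_ge0 => x _; rewrite mulr_ge0 ?sqr_ge0.
  have Y0 : 0 <= Y by apply: sumr_ge0 => x _; rewrite sqr_ge0.
  have XE : X <= E3.
    apply: ler_sum => x _; rewrite /w /indic; case: (x \in _).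
      by rewrite mul1r -exprS.
    by rewrite !mul0r exprn_ge0.
  have YE : Y * 2%:R ^+ i <= E3.
    rewrite mulr_suml; apply: ler_sum => x _; rewrite /w /indic inE; case: andP => [[_ hi]|_].
      rewrite mul1r [leRHS]exprSr ler_wpM2l ?sqr_ge0 // corr_indic -natrX ler_nat.
      by apply: leq_trans hi; rewrite leq_exp2l.
    by rewrite mul0r expr0n mul0r exprn_ge0.
  have -> : d i ^+ 4 * (X ^+ 2 * Y * (p%:R * E)) * 2%:R ^+ i =
     d i ^+ 4 * (X ^+ 2 * (Y * 2%:R ^+ i) * (p%:R * E)) :> R by ring.
  rewrite ler_wpM2l ?exprn_ge0 // ler_wpM2r // (exprSr E3 2) ler_pM ?sqr_ge0 //.
    by rewrite mulr_ge0 ?exprn_ge0.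
  by rewrite lerXn2r ?nnegrE.
Qed.

End EnergyBound.

(** * Absorbing the logarithms *)

Section Asymptotics.
Variable R : realType.

Lemma ln2_gt0 : 0 < ln 2%:R :> R.
Proof. by rewrite ln_gt0 // ltr1n. Qed.

Lemma dyadic_range_le p : (0 < p)%N ->
  (dyadic_range p)%:R <= 1 + ln p%:R / ln 2%:R :> R.
Proof.
move=> p0; rewrite /dyadic_range -natr1 [leLHS]addrC lerD2l ler_pdivlMr ?ln2_gt0 //.
have /andP[lo _] := trunc_log_bounds (isT : (1 < 2)%N) p0.
rewrite -ln_exp ?ltr0n // ler_ln ?posrE ?exprn_gt0 ?ltr0n //.
by rewrite -natrX ler_nat.
Qed.

(** The logarithm of log p is at most a small multiple of log p; the slope eta is
chosen so that the terms linear in ln p amount to half of e ln p. *)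
Lemma log_loss_le (c : nat) (e : R) : (0 < c)%N -> 0 < e ->
  exists p0 : nat, forall p : nat, (p0 <= p)%N -> (0 < p)%N ->
  20%:R * (ln (10 * c * dyadic_range p)%:R + ln (dyadic_range p)%:R + ln 2%:R)
    <= e * ln p%:R.
Proof.
move=> c0 e0; have l2 := ln2_gt0.
(* 40 eta / ln 2 = e / 2 *)
pose eta := e * ln 2%:R / 80%:R.
have eta0 : 0 < eta by rewrite divr_gt0 ?mulr_gt0.
pose C := 20%:R * (ln (10 * c)%:R + ln 2%:R + 2%:R * (eta - ln eta)).
pose M := 2%:R * C / e.
exists (Num.bound (sequences.expR M)) => p pM p0.
have P0 : 0 < p%:R :> R by rewrite ltr0n.
have MP : M <= ln p%:R.
  rewrite -(expRK M) ler_ln ?posrE ?expR_gt0 //.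
  apply: le_trans (_ : (Num.bound (sequences.expR M))%:R <= _); last by rewrite ler_nat.
  by apply/ltW/archi_boundP/expR_ge0.
have K0 : 0 < (dyadic_range p)%:R :> R by rewrite ltr0n.
have lK : ln (dyadic_range p)%:R <= eta * (dyadic_range p)%:R - ln eta :> R.
  have := ln_sublinear (mulr_gt0 eta0 K0); rewrite ln_mul // => h; lra.
have Kp := dyadic_range_le p0.
have etaK : eta * (dyadic_range p)%:R <= eta + e / 80%:R * ln p%:R.
  apply: le_trans (ler_wpM2l (ltW eta0) Kp) _.
  by rewrite mulrDr mulr1 lerD2l le_eqVlt /eta; apply/orP; left; apply/eqP; field; rewrite gt_eqF.
have CM : 2%:R * C <= e * ln p%:R by rewrite [leRHS]mulrC -ler_pdivrMr.
rewrite natrM ln_mul // ?ltr0n ?muln_gt0 ?c0 //.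
by move: CM; rewrite /C; move: (ln (10 * c)%:R) (ln (dyadic_range p)%:R) lK etaK => *; lra.
Qed.

End Asymptotics.

Section SubgroupOfUnits.
Variables (p : nat) (G : {group {unit 'F_p}}).
Hypothesis p_pr : prime p.

Lemma val_unit_inj : injective (fun g : {unit 'F_p} => val g).
Proof. exact: val_inj. Qed.

(** A subgroup of order T consists of T-th roots of unity, and there are at most T of
them. *)
Lemma unity_roots_group : unity_roots 'F_p #|G| = [set val g | g in G].
Proof.
apply/esym/eqP; rewrite eqEcard; apply/andP; split.
  apply/subsetP => _ /imsetP[g gG ->]; rewrite inE.
  have := expg_cardG gG => /(congr1 val) /=.
  by rewrite FinRing.val_unitX => ->.
by rewrite (card_imset _ val_unit_inj) card_pow_fiber.
Qed.

Lemma card_unity_group : #|unity_roots 'F_p #|G| | = #|G|.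
Proof. by rewrite unity_roots_group (card_imset _ val_unit_inj). Qed.

Lemma sum_group (V : nmodType) (f : 'F_p -> V) :
  \sum_(g in G) f (val g) = \sum_(x in unity_roots 'F_p #|G|) f x.
Proof. by rewrite unity_roots_group big_imset //=; apply: in2W; apply: val_unit_inj. Qed.
End SubgroupOfUnits.

Local Open Scope complex_scope.

Theorem theorem4 (R : realType) (e : R) (e_gt0 : 0 < e) :
  exists p0 : nat, forall p : nat, prime p -> (p0 <= p)%N ->
    forall (G : {group {unit 'F_p}}),
    #|G|%:R <= p%:R `^ (2 / 3) :> R ->
    forall (a : 'F_p) (chi : 'F_p -> R[i]),
    a != 0 -> mult_char chi -> nonprincipal chi ->
    `|\sum_(l in G) \sum_(m in G) chi (a + val l + val m)|
      <= (char_sum_bound p #|G| e)%:C.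
Proof.
have [c c_ge] : exists c, (2 ^ 23 <= c)%N by move: (2 ^ 23)%N => n; exists n.
have c0 : (0 < c)%N by apply: leq_trans c_ge; rewrite expn_gt0.
have [p1 loss_le] := log_loss_le c0 e_gt0.
(* p >= 17 ^ 3 and T ^ 3 <= p ^ 2 give 17 T <= p *)
exists (maxn p1 (17 ^ 3)) => p p_pr; rewrite geq_max => /andP[p1p p17] G TP a chi a0 chiP chi_np.
set T := #|G| in TP *.
have T_gt0 : (0 < T)%N := cardG_gt0 G.
have cardT : #|unity_roots 'F_p T| = T by apply: card_unity_group.
have p_gt0 := prime_gt0 p_pr.
have {}loss_le := loss_le p p1p p_gt0.
have -> : \sum_(l in G) \sum_(m in G) chi (a + val l + val m) = shifted_sum chi T a.
  rewrite /shifted_sum -sum_group; apply: eq_bigr => l _.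
  by rewrite -(sum_group _ (fun m => chi (a + val l + m))).
rewrite cabsE lecR.
have := shifted_sum_energy chiP chi_np T_gt0 cardT a0; rewrite card_Fp //.
set s := cabs _; set E := \sum_x _ => sE.
have T0 : 0 < T%:R :> R by rewrite ltr0n.
have P0 : 0 < p%:R :> R by rewrite ltr0n.
have lT0 : 0 <= ln T%:R :> R by rewrite ln_ge0 // ler1n.
have lP0 : 0 <= ln p%:R :> R by rewrite ln_ge0 // ler1n.
have elP : 0 <= e * ln p%:R by rewrite mulr_ge0 // ltW.
have [s0|s0] := leP s 0.
  apply: le_trans s0 _; rewrite /char_sum_bound.
  by case: ifP => _; [|case: ifP => _]; rewrite ?mulr_ge0 ?powR_ge0.
have E0 : 0 < E.
  by apply: lt_le_trans (energy_ge R cardT); rewrite exprn_gt0.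
have ls : ln T%:R + 2%:R * ln s <= ln p%:R + ln E.
  have := ln_le (mulr_gt0 T0 (exprn_gt0 2 s0)) sE.
  by rewrite (ln_mul T0 (exprn_gt0 2 s0)) (ln_exp 2 s0) (ln_mul P0 E0).
have lnpow x : ln (p%:R `^ x) = x * ln p%:R :> R by rewrite ln_powR.
have lTP : ln T%:R <= 2 / 3 * ln p%:R :> R by rewrite -lnpow; apply: ln_le.
have T3 : (T ^ 3 <= p ^ 2)%N.
  rewrite -(ler_nat R) !natrX -ler_ln ?posrE ?exprn_gt0 // !ln_exp //; lra.
rewrite /char_sum_bound; case: ifPn => [T12|].
  have lT12 : ln T%:R <= 1 / 2 * ln p%:R :> R by rewrite -lnpow; apply: ln_le.
  have TT : (T * T <= p)%N.
    by rewrite -(ler_nat R) natrM -ler_ln ?posrE ?mulr_gt0 // ln_mul //; lra.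
  have := energy_bound_small R p_pr T_gt0 cardT c_ge TT; rewrite -/E => lE.
  rewrite -ler_ln ?posrE ?mulr_gt0 ?powR_gt0 // ln_mul ?powR_gt0 // !ln_powR; lra.
rewrite -ltNge => T12.
have lT12 : 1 / 2 * ln p%:R <= ln T%:R :> R.
  by rewrite -lnpow; apply: ln_le; rewrite ?powR_gt0 // ltW.
have TT : (p <= T * T)%N.
  by rewrite -(ler_nat R) natrM -ler_ln ?posrE ?mulr_gt0 // ln_mul //; lra.
have T17 : (17 * T <= p)%N.
  by rewrite -(@leq_exp2r _ _ 3) // expnMn (expnS p) leq_mul.
have := energy_bound_large R p_pr T_gt0 cardT c_ge TT T17 T3; rewrite -/E => lE.
case: ifPn => [T29|].
  have lT29 : ln T%:R <= 29 / 48 * ln p%:R :> R by rewrite -lnpow; apply: ln_le.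
  rewrite -ler_ln ?posrE ?mulr_gt0 ?powR_gt0 // ln_mul ?powR_gt0 // !ln_powR.
  by case: lE => lE; lra.
rewrite -ltNge => T29.
have lT29 : 29 / 48 * ln p%:R <= ln T%:R :> R.
  by rewrite -lnpow; apply: ln_le; rewrite ?powR_gt0 // ltW.
rewrite -ler_ln ?posrE ?mulr_gt0 ?powR_gt0 // ln_mul ?powR_gt0 // ln_powR.
by case: lE => lE; lra.
Qed.
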